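(* Let $n,s$ be integers satisfying $s\leq \frac{n}{2^{17}\log n}$. Let $\mathcal{F}\subset \mathcal D_n$ be a family of derangements such that $\nu(\mathcal{F})<s$. Then $|\mathcal{F}|\leq (s-1)d_{n,1}$. Moreover, in the case of equality, $\mathcal{F}$ is of the form $\bigcup_{i=1}^{s-1}\mathcal D_n[(x,y_i)]$ or $\bigcup_{i=1}^{s-1}\mathcal D_n[(x_i,y)]$, where the $y_i$'s, respectively the $x_i$'s, are distinct and all the pairs $(x,y_i)$, respectively $(x_i,y)$, are off-diagonal (i.e. have distinct coordinates).
   Context: $\Sigma_n$ is the set of permutations of $[n]$; a permutation is identified with its graph $\{(i,\sigma(i))\}\subset[n]^2$, two permutations intersect iff they agree at some point, and $\nu(\mathcal{F})$ is the maximum number of pairwise non-intersecting members of $\mathcal{F}$. $\mathcal D_n$ is the set of derangements (permutations with no fixed point). For a pair $(x,y)$, $\mathcal D_n[(x,y)]$ is the set of derangements $\pi$ with $\pi(x)=y$, and $d_{n,1}:=|\mathcal D_n[(x,y)]|$ for any $x\ne y$ (this does not depend on the choice of $x\neq y$). *)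

(* Defs.v *)
From mathcomp Require Import all_boot all_fingroup.
From Stdlib Require Import Reals.

Set Implicit Arguments.
Unset Strict Implicit.
Unset Printing Implicit Defensive.

Definition derangement n (s : {perm 'I_n}) : bool := [forall i, s i != i].

Definition Dn n : {set {perm 'I_n}} := [set s | derangement s].

Definition Dpair n (x y : 'I_n) : {set {perm 'I_n}} :=
  [set s | derangement s && (s x == y)].

Definition intersecting n (s t : {perm 'I_n}) : bool := [exists i, s i == t i].

Definition pairwise_nonintersecting n (G : {set {perm 'I_n}}) : bool :=
  [forall s in G, forall t in G, (s != t) ==> ~~ intersecting s t].

Definition nu n (F : {set {perm 'I_n}}) : nat :=
  \max_(G : {set {perm 'I_n}} | (G \subset F) && pairwise_nonintersecting G) #|G|.

(* d_{n,1} = |D_n[(x,y)]| for x <> y; computed with x = 0, y = 1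
   (the value is independent of the choice; it is 0 when n < 2,
   where no off-diagonal pair exists). *)
Definition d_n1 n : nat :=
  #|[set s : {perm 'I_n} | derangement s &&
      [exists x : 'I_n, (val x == 0) && (val (s x) == 1)]]|.

(* Main.v *)
(** Identify a permutation with its graph.  Call a pair [e] dense when [F] contains almost
    all derangements through [e], and let [E] be the set of dense pairs.

    The engine is the spread lemma: families in which every nonempty set [Z] has relative
    degree at most [R ^ - #|Z|], with [R] of order [s log n], have pairwise disjoint
    representatives.  Colour the ground set at random; inside its own colours, each family is
    thinned round by round, replacing its sets by minimal fragments, whose size is halved in
    most rounds.

    The stars of dense pairs are spread, so [#|E| < s].  The members of [F] avoiding [E] are,
    up to a negligible remainder, covered by kernels of size at most [log n] carrying spread
    subfamilies; the spread lemma forbids [s - #|E|] disjoint kernels.  Peeling the kernels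
    from large to small sizes leaves at most [u = s - 1 - #|E|] single pairs, none of them dense,
    plus lower order terms.  Hence the members of [F] avoiding [E] number less than
    [u * d_n1 n] when [u > 0].  When [u = 0], a permutation of [F] avoiding [E] would extend
    to [s] disjoint members of [F]: a switching argument shows that a positive proportion of
    each dense star avoids it, and these parts are still spread.  So [F] is covered by the
    stars of the [s - 1] dense pairs, and equality forces these to be full and pairwise
    disjoint, i.e. the pairs to be collinear. *)

From Stdlib Require Import Reals Lra Lia.
From mathcomp Require Import all_boot all_fingroup.
From mathcomp Require Import zify_ssreflect.
Require Import Defs.

(* [zify_ssreflect] rebinds the key [%R] to a ring scope. *)
Delimit Scope R_scope with R.

Set Implicit Arguments.
Unset Strict Implicit.
Unset Printing Implicit Defensive.

(** * Powers against falling factorials, and preliminaries on spread families *)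

Lemma expSn_le_double k h : h.*2 <= k.+1 -> k.+1 ^ h <= 2 * k ^ h.
Proof.
move=> hk.
(* Bernoulli's inequality for (1 - 1/(k+1))^i, cleared of denominators. *)
have bern i : k.+1 ^ i * (k.+1 - i) <= k.+1 * k ^ i.
  elim: i => [|i IH]; first by rewrite !expn0 mul1n muln1; lia.
  rewrite !expnS.
  have := leq_mul (leqnn k) IH; nia.
have := bern h; case: h hk {bern} => [|h] hk //.
have : 0 < k.+1 ^ h.+1 by rewrite expn_gt0.
have : k.+1 <= 2 * (k.+1 - h.+1) by lia.
nia.
Qed.

Lemma expSn_le4 n t : t <= n -> n.+1 ^ t <= 4 * n ^ t.
Proof.
move=> tn.
have -> : t = t./2 + uphalf t by rewrite addnC uphalf_half -addnA addnn odd_double_half.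
have a : n.+1 ^ t./2 <= 2 * n ^ t./2 by apply: expSn_le_double; lia.
have b : n.+1 ^ uphalf t <= 2 * n ^ uphalf t by apply: expSn_le_double; lia.
rewrite !expnD; have := leq_mul a b; nia.
Qed.

Lemma expn_le_ffact n t : t <= n -> n ^ t <= 4 ^ t * n ^_ t.
Proof.
elim: n t => [|n IH] [|t] //; rewrite ltnS => tn.
rewrite ffactnS /= !expnS.
have := leq_trans (expSn_le4 tn) (leq_mul (leqnn 4) (IH _ tn)).
by move=> h; have := leq_mul (leqnn n.+1) h; nia.
Qed.

(** A substitute for Stirling's formula: the t factors of n!/(n-t)! have geometric mean at least
    n/4. This is what makes stars of permutations spread. *)
Lemma expn_fact_le b n t : t <= n -> 4 * b <= n -> b ^ t * (n - t)`! <= n`!.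
Proof.
move=> tn bn; rewrite -(ffact_fact tn) leq_mul2r; apply/orP; right.
case: t tn => // t tn.
rewrite -(leq_pmul2l (_ : 0 < 4 ^ t.+1)) ?expn_gt0 //.
by rewrite -expnMn; apply: leq_trans (expn_le_ffact tn); rewrite leq_exp2r.
Qed.

(** The normalisation [M] is kept apart from [#|A|], so that the property survives thinning the
    family and shrinking its sets. Members are indexed by [I] because different members may shrink
    to the same set. *)
Definition spread (X I : finType) (A : {set I}) (T : I -> {set X}) (R M : nat) :=
  forall Z : {set X}, #|[set a in A | Z \subset T a]| * R ^ #|Z| <= M.

Lemma spread_sub (X I : finType) (A B : {set I}) (T U : I -> {set X}) R M :
  B \subset A -> (forall a, a \in B -> U a \subset T a) ->
  spread A T R M -> spread B U R M.
Proof.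
move=> BA UT sA Z; apply: leq_trans (sA Z); rewrite leq_mul2r; apply/orP; right.
apply/subset_leq_card/subsetP => a; rewrite !inE => /andP[aB ZU].
by rewrite (subsetP BA) //= (subset_trans ZU) // UT.
Qed.

(** The expansion of (q+1)^|D|, read on colourings: [W] is the class of one colour, and q^|D\W|
    counts the colourings of the rest with the other q colours. *)
Lemma sum_subsets_exp (X : finType) (D : {set X}) q :
  \sum_(W in powerset D) q ^ #|D :\: W| = q.+1 ^ #|D|.
Proof.
have : \prod_(i : X) ((i \in D) + (if i \in D then q else 1)) =
  \sum_(J : {set X}) \prod_i (if i \in J then i \in D : nat else if i \in D then q else 1).
  by rewrite bigA_distr.
rewrite (bigID (mem D)) /= [X in _ * X]big1 ?muln1; last first.
  by move=> i /negbTE ->.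
rewrite (eq_bigr (fun=> q.+1)); last by move=> i ->; rewrite add1n.
rewrite prod_nat_const => ->.
rewrite [RHS](bigID (fun J => J \in powerset D)) /= [X in _ + X]big1 ?addn0; last first.
  move=> J; rewrite powersetE => /subsetPn[x xJ xD].
  by rewrite (bigD1 x) //= xJ (negbTE xD).
apply: eq_bigr => J.
rewrite powersetE => JD.
rewrite (bigID (mem J)) /= big1 ?mul1n; last first.
  by move=> x xJ; rewrite xJ (subsetP JD).
rewrite (bigID (mem D)) /= [X in _ * X]big1 ?muln1; last first.
  by move=> x /andP[/negbTE -> /negbTE ->].
rewrite (eq_bigr (fun=> q)); last by move=> x /andP[/negbTE -> ->].
by rewrite prod_nat_const; congr (_ ^ _); apply: eq_card => x; rewrite !inE.
Qed.

Lemma leq_card_bigcup (I T : finType) (P : pred I) (F : I -> {set T}) :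
  #|\bigcup_(i | P i) F i| <= \sum_(i | P i) #|F i|.
Proof.
elim/big_rec2: _ => [|i m B _ IH]; first by rewrite cards0.
by apply: leq_trans (leq_card_setU _ _) _; rewrite leq_add2l.
Qed.

(** * Spread families have disjoint representatives *)

(** If the part of this member outside [W] later receives good colours, then the whole member is
    well coloured, and it may stand for [a]. It has the fewest points left to colour among members
    inside [T a :|: W]. *)
Definition frag_idx (X I : finType) (A : {set I}) (T : I -> {set X}) (W : {set X}) (a : I) : I :=
  [arg min_(b < a | (b \in A) && (T b \subset T a :|: W)) #|T b :\: W|].

Definition frag (X I : finType) (A : {set I}) (T : I -> {set X}) (W : {set X}) (a : I) :=
  T (frag_idx A T W a) :\: W.

Definition bad_frag (X I : finType) (A : {set I}) (T : I -> {set X}) k (W : {set X}) :=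
  [set a in A | k < 2 * #|frag A T W a|].

Lemma frag_idxP (X I : finType) (A : {set I}) (T : I -> {set X}) W a :
  a \in A ->
  [/\ frag_idx A T W a \in A, T (frag_idx A T W a) \subset T a :|: W
    & forall b, b \in A -> T b \subset T a :|: W -> #|frag A T W a| <= #|T b :\: W|].
Proof.
rewrite /frag /frag_idx => aA.
case: arg_minnP => [|b /andP[bA bT] bmin]; first by rewrite aA subsetUl.
by split=> // c cA cT; apply: bmin; rewrite cA.
Qed.

Lemma frag_sub (X I : finType) (A : {set I}) (T : I -> {set X}) W a :
  a \in A -> frag A T W a \subset T a :\: W.
Proof.
case/(@frag_idxP _ _ A T W) => _ sTW _; apply/subsetP => x; rewrite !inE => /andP[xW xT].
by rewrite xW; have := subsetP sTW x xT; rewrite !inE (negbTE xW) orbF.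
Qed.

(* A pair [(W, a)] is recovered from [Z = W :|: t] and [t], where [t] is the
   fragment; minimality forces [t] to lie inside any [T b] contained in [Z], so
   once [Z] is known there are at most [2 ^ k] choices for [t]. *)
Lemma sum_bad_frag (X I : finType) (D : {set X}) (A : {set I}) (T : I -> {set X})
    k q R M :
  0 < k -> 2 ^ 7 * q <= R ->
  (forall a, a \in A -> T a \subset D /\ #|T a| <= k) -> spread A T R M ->
  (\sum_(W in powerset D) q ^ #|D :\: W| * #|bad_frag A T k W|) * 2 ^ (k + k + 4)
    <= M * q.+1 ^ #|D|.
Proof.
move=> k0 qR TD sA.
(* A member inside [Z] selected from [Z] alone; the fragment is one of its at most 2^k subsets. *)
pose B (Z : {set X}) := if [pick b in A | T b \subset Z] is Some b then T b else set0.
have BS Z : #|B Z| <= k.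
  rewrite /B; case: pickP => [b /andP[bA _]|_]; last by rewrite cards0.
  by case: (TD b bA).
pose w (W : {set X}) := q ^ #|D :\: W|.
pose P (p : {set X} * I) := (p.1 \in powerset D) && (p.2 \in bad_frag A T k p.1).
pose h (p : {set X} * I) := let t := frag A T p.1 p.2 in (p.1 :|: t, (t, p.2)).
pose Q (p : {set X} * ({set X} * I)) := (p.1 \in powerset D) &&
   (((p.2.1 \in powerset (B p.1)) && (k < 2 * #|p.2.1|)) &&
     ((p.2.2 \in A) && (p.2.1 \subset T p.2.2))).
pose v (p : {set X} * ({set X} * I)) := w p.1 * q ^ #|p.2.1|.
have PW p : P p -> Q (h p) /\ w p.1 = v (h p).
  case: p => W a; rewrite /P /= powersetE inE => /andP[WD /andP[aA kt]].
  have [iA iT imin] := @frag_idxP _ _ A T W a aA.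
  have /subsetP tS := @frag_sub _ _ A T W a aA.
  have [TaD _] := TD a aA.
  set t := frag A T W a in kt imin tS *.
  have tD : t \subset D.
    by apply/subsetP => x /tS; rewrite inE => /andP[_ /(subsetP TaD)].
  have tB : t \subset B (W :|: t).
    rewrite /B; case: pickP => [b /andP[bA bZ]|/(_ (frag_idx A T W a))]; last first.
      rewrite iA /= => /negbT/subsetPn[x xT]; rewrite in_setU negb_or => /andP[xW].
      by rewrite /t /frag inE xW xT.
    have bt : T b :\: W \subset t.
      by apply/subsetP => x; rewrite inE => /andP[xW /(subsetP bZ)]; rewrite inE (negbTE xW).
    have bTa : T b \subset T a :|: W.
      apply/subsetP => x /(subsetP bZ); rewrite !in_setU => /orP[->|/tS]; first by rewrite orbT.
      by rewrite inE => /andP[_ ->].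
    have /eqP <- : T b :\: W == t by rewrite eqEcard bt imin.
    exact: subsetDl.
  split.
    rewrite /Q /= !powersetE subUset WD tD tB kt aA /=.
    by apply/subsetP => x /tS; rewrite inE => /andP[].
  rewrite /v /w /= -expnD; congr (_ ^ _).
  rewrite -setDDl [in RHS]cardsD (setIidPr _) ?subnK //.
    apply: subset_leq_card; apply/subsetP => x xt.
    by have := tS x xt; rewrite !inE => /andP[-> _]; rewrite (subsetP tD).
  apply/subsetP => x xt.
  by have := tS x xt; rewrite !inE => /andP[-> _]; rewrite (subsetP tD).
have hinj : {in [set p | P p] &, injective h}.
  have rec p : P p -> p.1 = (h p).1 :\: (h p).2.1.
    case: p => W a; rewrite /P /= inE => /andP[WD]; rewrite inE => /andP[aA _].
    have /subsetP tS := @frag_sub _ _ A T W a aA.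
    apply/setP => x; rewrite in_setD in_setU; case: (boolP (x \in frag A T W a)) => [xt|_] /=.
      by have := tS x xt; rewrite inE => /andP[/negbTE ->].
    by rewrite orbF.
  move=> p1 p2; rewrite !inE => P1 P2 e.
  have e1 : p1.1 = p2.1 by rewrite (rec _ P1) (rec _ P2) e.
  have e2 : p1.2 = p2.2 by case: e.
  by rewrite (surjective_pairing p1) e1 e2 -surjective_pairing.
have step1 : \sum_(W in powerset D) w W * #|bad_frag A T k W| <= \sum_(p | Q p) v p.
  under eq_bigr do rewrite mulnC -sum_nat_const.
  rewrite pair_big_dep /= -[X in X <= _]/(\sum_(p | P p) w p.1).
  rewrite (eq_bigr (fun p => v (h p))); last by move=> p /PW[].
  rewrite (eq_bigl (fun p => p \in [set p | P p])); last by move=> p; rewrite inE.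
  rewrite -(big_imset (fun r => v r) hinj) /=.
  rewrite [X in _ <= X](bigID (fun r => r \in h @: [set p | P p])) /=.
  apply: leq_trans (leq_addr _ _).
  rewrite [X in _ <= X](eq_bigl (fun r => r \in h @: [set p | P p])) // => r.
  case: (boolP (r \in _)) => [/imsetP[p]|]; last by rewrite andbF.
  by rewrite inE => /PW[Qp _] ->; rewrite Qp.
(* For fixed [Z] and [t], spreadness leaves at most M/R^|t| indices. This cancels q^|t| and gains
   2^(7|t|), at least 2^(3k+4) because 2|t| > k >= 1. The choices of [t] cost 2^k of it. *)
have step2 : (\sum_(p | Q p) v p) * 2 ^ (3 * k + 4) <= (2 ^ k * M) * q.+1 ^ #|D|.
  rewrite -[X in X * _](pair_big_dep (fun Z => Z \in powerset D)
    (fun Z (r : {set X} * I) => ((r.1 \in powerset (B Z)) && (k < 2 * #|r.1|)) &&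
     ((r.2 \in A) && (r.1 \subset T r.2))) (fun Z r => v (Z, r))) /=.
  rewrite -sum_subsets_exp !big_distrl !big_distrr /=; apply: leq_sum => Z _.
  rewrite -(pair_big_dep (fun t => (t \in powerset (B Z)) && (k < 2 * #|t|))
    (fun t a => (a \in A) && (t \subset T a)) (fun t a => v (Z, (t, a)))) /=.
  rewrite big_distrl /=.
  apply: leq_trans (_ : \sum_(t in powerset (B Z)) M * w Z <= _); last first.
    rewrite sum_nat_const card_powerset mulnA leq_mul2r leq_mul2r.
    by rewrite leq_exp2l // BS !orbT.
  rewrite [X in _ <= X](bigID (fun t : {set X} => k < 2 * #|t|)) /=.
  apply: leq_trans (leq_addr _ _).
  apply: leq_sum => t /andP[_ kt].
  rewrite (eq_bigl (fun a => a \in [set a in A | t \subset T a])); last first.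
    by move=> a; rewrite inE.
  rewrite /v /= sum_nat_const.
  have st := sA t.
  have e1 : (2 ^ 7 * q) ^ #|t| <= R ^ #|t| by case: #|t| => // j; rewrite leq_exp2r.
  have e2 : 2 ^ (3 * k + 4) <= 2 ^ (7 * #|t|) by rewrite leq_exp2l //; lia.
  have := leq_trans (leq_mul (leqnn _) e1) st; rewrite expnMn -expnM => st'.
  have := leq_trans (leq_mul (leqnn _) (leq_mul e2 (leqnn _))) st' => st''.
  have := leq_mul (leqnn (w Z)) st''.
  by congr (_ <= _); rewrite ?(mulnC M) // !mulnA; lia.
have := leq_trans (leq_mul step1 (leqnn _)) step2.
have -> : 2 ^ (3 * k + 4) = 2 ^ (k + k + 4) * 2 ^ k by rewrite -expnD; congr (_ ^ _); lia.
rewrite mulnA (mulnC (2 ^ k) M) -!mulnA [2 ^ k * _]mulnC !mulnA leq_mul2r.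
by rewrite expn_eq0.
Qed.

(** The colours [cs] are those reserved for the family. Points outside [D] carry the default [c0],
    so the ambient colourings number |C|^|D|. *)
Definition colour_fail (X I K : finType) (c0 : K) (D : {set X}) (C : {set K})
    (A : {set I}) (T : I -> {set X}) (cs : seq K) : {set {ffun X -> K}} :=
  [set f in pffun_on c0 (mem D) (mem C) |
    [forall a in A, ~~ (T a \subset [set x | f x \in cs])]].

(** Condition on the class [W] of colour [c]: if some [T' W a] were coloured from [cs], the member
    [b] inside [T' W a :|: W] would be coloured from [c :: cs]. *)
Lemma colour_fail_split (X I K : finType) (c0 : K) (D : {set X}) (C : {set K})
    (A : {set I}) (T : I -> {set X}) (c : K) (cs : seq K)
    (A' : {set X} -> {set I}) (T' : {set X} -> I -> {set X}) :
  (forall (W : {set X}) a, W \subset D -> a \in A' W -> exists2 b, b \in A & T b \subset T' W a :|: W) ->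
  #|colour_fail c0 D C A T (c :: cs)| <=
  \sum_(W in powerset D) #|colour_fail c0 (D :\: W) (C :\ c) (A' W) (T' W) cs|.
Proof.
move=> AT.
pose cl (f : {ffun X -> K}) := [set x in D | f x == c].
rewrite -sum1_card (partition_big cl (fun W => W \in powerset D)) /=; last first.
  by move=> f _; rewrite powersetE; apply/subsetP => x; rewrite inE => /andP[].
apply: leq_sum => W; rewrite powersetE => WD.
(* Resetting [W] to the default loses no information, since every point of [W] had colour [c]. *)
pose g (f : {ffun X -> K}) : {ffun X -> K} := [ffun x => if x \in W then c0 else f x].
rewrite sum1dep_card -(@card_in_imset _ _ g); last first.
  move=> f1 f2; rewrite !inE => /andP[_ /eqP e1] /andP[_ /eqP e2] /ffunP e.
  apply/ffunP => x; have := e x; rewrite !ffunE; case: ifP => // xW _.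
  have x1 : x \in cl f1 by rewrite e1.
  have x2 : x \in cl f2 by rewrite e2.
  by move: x1 x2; rewrite !inE => /andP[_ /eqP ->] /andP[_ /eqP ->].
apply: subset_leq_card; apply/subsetP => f1 /imsetP[f].
rewrite !inE => /andP[/andP[/pffun_onP[fD fC] /forall_inP fail] /eqP eW] ->.
apply/andP; split.
  apply/pffun_onP; split.
    apply/subsetP => x; rewrite !inE ffunE; case: ifP => [_|_]; first by rewrite eqxx.
    by move=> fx /=; have := subsetP fD x; rewrite inE; apply.
  move=> y /imageP[x]; rewrite !inE => /andP[xW xD] ->.
  rewrite ffunE (negbTE xW) fC ?andbT; last by apply/imageP; exists x.
  by apply: contra xW => /eqP fx; rewrite -eW inE xD fx eqxx.
apply/forall_inP => a aA'; have [b bA bT] := AT W a WD aA'.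
apply: contra (fail b bA) => /subsetP sT; apply/subsetP => x /(subsetP bT).
have xc : x \in W -> (x \in [set x | f x \in c :: cs]).
  by rewrite -eW !inE => /andP[_ ->].
rewrite in_setU => /orP[xT|] //; have := sT x xT; rewrite inE ffunE.
by case: ifP => [/xc //|_ fx]; rewrite !inE fx orbT.
Qed.

Lemma card_colour_fail_le (X I K : finType) (c0 : K) (D : {set X}) (C : {set K})
    (A : {set I}) (T : I -> {set X}) cs :
  #|colour_fail c0 D C A T cs| <= #|C| ^ #|D|.
Proof.
rewrite -(card_pffun_on c0 (mem D) (mem C)); apply: subset_leq_card.
by apply/subsetP => f; rewrite inE => /andP[].
Qed.

(* One round either halves the size bound [k], losing at most [M / 2 ^ k.+1] sets, or fails
   with probability at most 1/16.  So the failure probability obeys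
   [p L.+1 j.+1 <= p L j + p L j.+1 / 16], which [8 ^ j / 4 ^ L] satisfies. *)
Lemma colour_fail_bound (X I K : finType) (c0 : K) R M (cs : seq K) j k
    (D : {set X}) (C : {set K}) (A : {set I}) (T : I -> {set X}) :
  uniq cs -> {subset cs <= C} -> 2 ^ 7 * #|C| <= R -> 0 < M -> k < 2 ^ j ->
  (forall a, a \in A -> T a \subset D /\ #|T a| <= k) ->
  spread A T R M -> (M - #|A|) * 2 ^ k.+1 <= M ->
  #|colour_fail c0 D C A T cs| * 4 ^ size cs <= 8 ^ j * #|C| ^ #|D|.
Proof.
elim: cs j k D C A T => [|c cs IH] j k D C A T.
  move=> *; rewrite muln1; apply: leq_trans (card_colour_fail_le _ _ _ _ _ _) _.
  by rewrite leq_pmull // expn_gt0.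
move=> /= /andP[ccs ucs] csC CR M0 kj TD sA Ak.
(* With k = 0 the family is nonempty and its sets are empty, so no colouring fails. *)
have [k0|k0] := posnP k.
  have -> : colour_fail c0 D C A T (c :: cs) = set0; last by rewrite cards0.
  apply/setP => f; rewrite !inE; apply/negP => /andP[_ /forall_inP fail].
  have /card_gt0P[a aA] : 0 < #|A| by move: Ak; rewrite k0; lia.
  have := fail a aA; have [_] := TD a aA; rewrite k0 leqn0 cards_eq0 => /eqP ->.
  by rewrite sub0set.
case: j kj => [|j] kj; first by move: kj; rewrite expn0; lia.
have cC : c \in C by rewrite csC // mem_head.
set q := #|C :\ c|.
have qC : #|C| = q.+1 by rewrite /q (cardsD1 c C) cC.
have csC' : {subset cs <= C :\ c}.
  move=> d dcs; rewrite !inE csC ?andbT; last by rewrite inE dcs orbT.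
  by apply: contraNneq ccs => <-.
have qR : 2 ^ 7 * q <= R by apply: leq_trans CR; rewrite leq_mul2l qC leqnSn orbT.
(* The round fails for [W] when too many members are bad; then only [W] is removed from the sets.
   Otherwise bad members are dropped and the others replaced by fragments of size at most k/2. *)
pose fl (W : {set X}) := M < #|bad_frag A T k W| * 2 ^ k.+1.
pose A' (W : {set X}) := if fl W then A else A :\: bad_frag A T k W.
pose T' (W : {set X}) a := if fl W then T a :\: W else frag A T W a.
have AT (W : {set X}) a : W \subset D -> a \in A' W -> exists2 b, b \in A & T b \subset T' W a :|: W.
  move=> WD; rewrite /A' /T'; case: ifP => _ aA.
    by exists a => //; apply/subsetP => x xT; rewrite !inE xT andbT orNb.
  have {}aA : a \in A by move: aA; rewrite inE => /andP[].
  have [iA _ _] := @frag_idxP _ _ A T W a aA.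
  by exists (frag_idx A T W a) => //; apply/subsetP => x xT; rewrite !inE xT andbT orNb.
have IHW (W : {set X}) : W \subset D ->
    #|colour_fail c0 (D :\: W) (C :\ c) (A' W) (T' W) cs| * 4 ^ size cs
    <= 8 ^ (if fl W then j.+1 else j) * q ^ #|D :\: W|.
  move=> WD; rewrite /A' /T'; case: ifP => flW.
    apply: (IH _ k) => //.
      move=> a aA; have [aD ak] := TD a aA; rewrite setSD //; split=> //.
      exact: leq_trans (subset_leq_card (subsetDl _ _)) ak.
    by apply: spread_sub sA => // a _; apply: subsetDl.
  apply: (IH _ k./2) => //.
  - by move: kj; rewrite expnS; lia.
  - move=> a; rewrite !inE => /andP[nb aA]; rewrite aA /= -leqNgt in nb.
    have [aD _] := TD a aA; split; last by lia.
    by apply: subset_trans (frag_sub _ _ aA) _; rewrite setSD.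
  - apply: spread_sub sA => [|a]; first exact: subsetDl.
    rewrite inE => /andP[_ aA].
    by apply: subset_trans (frag_sub _ _ aA) _; apply: subsetDl.
  - have bA : bad_frag A T k W \subset A by apply/subsetP => a; rewrite inE => /andP[].
    rewrite cardsD (setIidPr bA).
    move/negbT: flW; rewrite -leqNgt => flW.
    (* The earlier and the new losses are at most M/2^(k+1) each. Their sum M/2^k is within the
       allowance for k/2, since floor(k/2) + 1 <= k. *)
    have le1 : (M - (#|A| - #|bad_frag A T k W|)) * 2 ^ k.+1 <= M + M.
      apply: leq_trans (leq_add Ak flW); rewrite -mulnDl leq_mul2r; apply/orP; right.
      by have := subset_leq_card bA; lia.
    have le2 : 2 ^ (k./2).+1 <= 2 ^ k by rewrite leq_exp2l //; lia.
    apply: leq_trans (leq_mul (leqnn _) le2) _.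
    by move: le1; rewrite expnS; lia.
(* Markov's inequality applied to the weighted count of bad members. *)
have wfl : (\sum_(W in powerset D | fl W) q ^ #|D :\: W|) * 16 <= #|C| ^ #|D|.
  have := sum_bad_frag k0 qR TD sA; rewrite -qC.
  set S := \sum_(W in powerset D) _ => hS.
  have h1 : M * (\sum_(W in powerset D | fl W) q ^ #|D :\: W|) <= S * 2 ^ k.+1.
    rewrite /S big_distrr big_distrl /= [X in _ <= X](bigID fl) /=.
    apply: leq_trans (leq_addr _ _); apply: leq_sum => W /andP[_ /ltnW flW].
    by rewrite -mulnA mulnC leq_mul2l flW orbT.
  rewrite -(leq_pmul2l M0) mulnA; apply: leq_trans hS.
  apply: leq_trans (leq_mul h1 (leqnn _)) _.
  rewrite -mulnA leq_mul2l; apply/orP; right.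
  have -> : k + k + 4 = k.+1 + 4 + k.-1 by lia.
  rewrite expnD; have -> : 16 = 2 ^ 4 by [].
  by rewrite -expnD leq_pmulr // expn_gt0.
rewrite expnSr mulnA.
apply: leq_trans (leq_mul (leq_mul (colour_fail_split c0 C c cs AT) (leqnn _)) (leqnn _)) _.
rewrite big_distrl /=.
apply: leq_trans (_ : (\sum_(W in powerset D) 8 ^ (if fl W then j.+1 else j) * q ^ #|D :\: W|) * 4 <= _).
  by rewrite leq_mul2r /=; apply: leq_sum => W; rewrite powersetE => /IHW.
rewrite (bigID fl) /=.
rewrite (eq_bigr (fun W => 8 ^ j.+1 * q ^ #|D :\: W|)); last by move=> W /andP[_ ->].
rewrite [X in _ + X](eq_bigr (fun W => 8 ^ j * q ^ #|D :\: W|)); last first.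
  by move=> W /andP[_ /negbTE ->].
rewrite -!big_distrr /=.
have := sum_subsets_exp D q; rewrite -qC (bigID fl) /=.
rewrite expnS; set x := 8 ^ j.
move: wfl; set s1 := \sum_(_ in _ | _) _; set s2 := \sum_(_ in _ | ~~ _) _.
set y := _ ^ _ => h1 h2.
have : 8 * s1 + s2 <= 2 * y by lia.
by move=> h; have := leq_mul (leqnn x) h; lia.
Qed.

(** Each of the k families owns 2l colours, so 2kl colours are used in all. After 2l rounds a family
    fails on a proportion at most 8^l/4^(2l) = 2^-l < 1/k of the colourings, and a union bound
    leaves one good for all. Different families own different colours, whence disjointness. *)
Lemma spread_disjoint (X I : finType) k l (A : 'I_k -> {set I})
    (T : 'I_k -> I -> {set X}) R :
  2 ^ 8 * (k * l) <= R -> k < 2 ^ l ->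
  (forall i, A i != set0) ->
  (forall i a, a \in A i -> #|T i a| < 2 ^ l) ->
  (forall i, spread (A i) (T i) R #|A i|) ->
  exists a : 'I_k -> I, (forall i, a i \in A i) /\
    forall i j, i != j -> [disjoint T i (a i) & T j (a j)].
Proof.
case: k A T => [|k] A T kR kl A0 Tl sA.
  by exists (fun i : 'I_0 => match notF (ltn_ord i) with end); split=> -[].
case: l kR kl Tl => [|l] kR kl Tl; first by move: kl; rewrite expn0.
(* The predecessor gives the colour type the shape ['I_L.+1], visibly nonempty; [L.+1] is twice the
   original [l]. *)
pose L := (2 * l.+1).-1.
pose K := ('I_k.+1 * 'I_L.+1)%type.
pose c0 : K := (ord0, ord0).
pose cs i : seq K := [seq (i, r) | r <- enum 'I_L.+1].
pose N := #|{: {ffun X -> K}}|.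
have N0 : 0 < N by apply/card_gt0P; exists [ffun=> c0].
have NK : #|[set: K]| ^ #|[set: X]| = N by rewrite !cardsT /N card_ffun.
have fail i : #|colour_fail c0 setT setT (A i) (T i) (cs i)| * 2 ^ l.+1 <= N.
  have := @colour_fail_bound X I K c0 R #|A i| (cs i) l.+1 (2 ^ l.+1).-1
     setT setT (A i) (T i).
  rewrite size_map size_enum_ord NK map_inj_uniq ?enum_uniq; last by move=> r1 r2 [].
  move=> /(_ isT (fun c _ => in_setT c)).
  rewrite cardsT card_prod !card_ord.
  have -> : 2 ^ 7 * (k.+1 * L.+1) <= R by move: kR; rewrite /L; lia.
  rewrite card_gt0 A0 subnn prednK ?expn_gt0 // leqnn.
  set fc := #|colour_fail _ _ _ _ _ _| => /(_ isT isT isT _ (sA i) isT) h.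
  have {h} : fc * 4 ^ L.+1 <= 8 ^ l.+1 * N.
    by apply: h => a aA; rewrite subsetT; split=> //; have := Tl i a aA; lia.
  have -> : L.+1 = 2 * l.+1 by rewrite /L; lia.
  rewrite expnM (_ : 4 ^ 2 = 8 * 2) // expnMn mulnCA leq_pmul2l //.
  by rewrite expn_gt0.
have [f /forallP fP] : exists f : {ffun X -> K},
    [forall i, f \notin colour_fail c0 setT setT (A i) (T i) (cs i)].
  apply/existsP; apply: contraT; rewrite negb_exists => /forallP fb.
  have : N <= \sum_i #|colour_fail c0 setT setT (A i) (T i) (cs i)|.
    rewrite -[N]cardsT.
    rewrite (_ : [set: _] = \bigcup_i colour_fail c0 setT setT (A i) (T i) (cs i)).
      exact: leq_card_bigcup.
    apply/setP => f; rewrite inE; apply/esym/bigcupP.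
    have := fb f; rewrite negb_forall => /existsP[i]; rewrite negbK.
    by exists i.
  move/(leq_mul (leqnn (2 ^ l.+1))); rewrite big_distrr /= => h.
  have : \sum_i 2 ^ l.+1 * #|colour_fail c0 setT setT (A i) (T i) (cs i)| <= k.+1 * N.
    rewrite -[k.+1 in X in _ <= X]card_ord -sum_nat_const; apply: leq_sum => i _.
    by rewrite mulnC.
  by move=> /(leq_trans h); rewrite leq_pmul2r // leqNgt kl.
have /fin_all_exists[a aP] i : exists a, (a \in A i) && (T i a \subset [set x | f x \in cs i]).
  have := fP i; rewrite inE.
  have -> : f \in pffun_on c0 (mem [set: X]) (mem [set: K]).
    by apply/pffun_onP; split=> [|c _]; rewrite ?in_setT //; apply/subsetP => x; rewrite in_setT.
  rewrite negb_forall => /existsP[a]; rewrite negb_imply negbK => h.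
  by exists a.
exists a; split=> [i|i j ij]; first by case/andP: (aP i).
case/andP: (aP i) (aP j) => _ /subsetP si /andP[_ /subsetP sj].
rewrite -setI_eq0; apply/eqP/setP => x; rewrite !inE; apply/negP => /andP[/si xi /sj].
move: xi; rewrite !inE => /mapP[r1 _ ->] /mapP[r2 _ [e _]].
by rewrite e eqxx in ij.
Qed.

(** Spreadness is only available off the kernels [S i]. Members meeting another kernel are
    discarded: each of the at most kl <= R points there meets a share 1/(2R), so half of the family
    remains. The kernel is then deleted; the factor 2 in [2 * R] pays for the halving when [Z] is
    nonempty. *)
Lemma spread_disjoint_off (X I : finType) k l (S : 'I_k -> {set X})
    (G : 'I_k -> {set I}) (g : I -> {set X}) R :
  2 ^ 8 * (k * l) <= R -> 0 < R -> k < 2 ^ l ->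
  (forall i a, a \in G i -> #|g a| < 2 ^ l /\ S i \subset g a) ->
  (forall i, #|S i| <= l) ->
  (forall i j, i != j -> [disjoint S i & S j]) ->
  (forall i, G i != set0) ->
  (forall i (Z : {set X}), Z != set0 -> [disjoint Z & S i] ->
     #|[set a in G i | Z \subset g a]| * (2 * R) ^ #|Z| <= #|G i|) ->
  exists a : 'I_k -> I, (forall i, a i \in G i) /\
    forall i j, i != j -> [disjoint g (a i) & g (a j)].
Proof.
move=> kR R0 kl gS Sl Sd G0 sG.
pose Y i := \bigcup_(j | j != i) S j.
pose A i := [set a in G i | [disjoint g a & Y i]].
have Ahalf i : #|G i| <= 2 * #|A i|.
  have dY y : y \in Y i -> y \notin S i.
    case/bigcupP => j ji yj; have := Sd _ _ ji; rewrite disjoint_subset => /subsetP/(_ _ yj).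
    by rewrite inE.
  have cY : #|Y i| <= k * l.
    apply: leq_trans (leq_card_bigcup _ _) _.
    apply: leq_trans (_ : \sum_(j < k) l <= _); last by rewrite sum_nat_const card_ord.
    rewrite [X in _ <= X](bigID (fun j => j != i)) /=.
    by apply: leq_trans (leq_addr _ _); apply: leq_sum.
  have AG : A i \subset G i by apply/subsetP => a; rewrite inE => /andP[].
  have := cardsD (G i) (A i); rewrite (setIidPr AG) => eD.
  have cD : #|G i :\: A i| * (2 * R) <= #|Y i| * #|G i|.
    apply: leq_trans (_ : (\sum_(y in Y i) #|[set a in G i | [set y] \subset g a]|) * (2 * R) <= _).
      rewrite leq_mul2r; apply/orP; right.
      apply: leq_trans (leq_card_bigcup _ _).
      apply/subset_leq_card/subsetP => a; rewrite !inE => /andP[+ aG]; rewrite aG /=.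
      rewrite -setI_eq0 => /set0Pn[y]; rewrite inE => /andP[yg yY].
      by apply/bigcupP; exists y => //; rewrite inE aG sub1set.
    rewrite big_distrl -sum_nat_const; apply: leq_sum => y /dY yS /=.
    have := sG i [set y]; rewrite cards1 expn1; apply.
      by apply/set0Pn; exists y; rewrite inE.
    by rewrite disjoints1.
  have := subset_leq_card AG.
  have : #|G i :\: A i| * (2 * R) <= R * #|G i|.
    apply: leq_trans cD _; rewrite leq_mul2r; apply/orP; right.
    by apply: leq_trans cY _; lia.
  by rewrite mulnC -mulnA mulnCA leq_pmul2l //; lia.
pose T i a := g a :\: S i.
have [] := @spread_disjoint X I k l A T R kR kl.
- move=> i; have := Ahalf i; rewrite -card_gt0; have := G0 i; rewrite -card_gt0; lia.
- move=> i a; rewrite inE => /andP[/gS[ga _] _].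
  by apply: leq_ltn_trans ga; apply/subset_leq_card/subsetDl.
- move=> i Z; have [->|Z0] := eqVneq Z set0.
    rewrite cards0 muln1; apply/subset_leq_card/subsetP => a.
    by rewrite inE => /andP[].
  have [dZ|] := boolP [disjoint Z & S i]; last first.
    rewrite -setI_eq0 => /set0Pn[y]; rewrite inE => /andP[yZ yS].
    rewrite (_ : [set _ in _ | _] = set0) ?cards0 //; apply/setP => a.
    rewrite !inE; apply/negP => /andP[_ /subsetP/(_ y yZ)].
    by rewrite !inE yS.
  have := leq_trans (sG i Z Z0 dZ) (Ahalf i); rewrite expnMn.
  have [z zE] : exists z, #|Z| = z.+1.
    by move: Z0; rewrite -card_gt0; case: #|Z| => // z _; exists z.
  have : #|[set a in A i | Z \subset T i a]| <= #|[set a in G i | Z \subset g a]|.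
    apply/subset_leq_card/subsetP => a; rewrite !inE => /andP[/andP[-> _]] /=.
    by move/subset_trans; apply; apply: subsetDl.
  rewrite zE [2 ^ _]expnS; set u := #|_|; set v := #|_|; set r := R ^ _ => uv h.
  rewrite -(leq_pmul2l (_ : 0 < 2)) //; apply: leq_trans h.
  have : 0 < 2 ^ z by rewrite expn_gt0.
  move=> h; have := leq_mul uv (leqnn r); move: h; nia.
- move=> a [aA dT]; exists a; split=> [i|i j ij].
    by have := aA i; rewrite inE => /andP[].
  have gY i' j' : i' != j' -> [disjoint g (a i') & S j'].
    move=> ne; have := aA i'; rewrite inE => /andP[_ ]; apply: disjointWr.
    by apply: bigcup_sup; rewrite eq_sym.
  have := dT i j ij; have d1 := gY i j ij.
  have d2 := gY j i; rewrite eq_sym in d2; have {}d2 := d2 ij.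
  rewrite -!setI_eq0 in d1 d2 *; move=> /eqP/setP d; apply/eqP/setP => x; rewrite !inE.
  have := d x; rewrite !inE.
  case: (boolP (x \in g (a i))) => xi; case: (boolP (x \in g (a j))) => xj //=.
    have -> : x \in S i = false.
      by apply/negP => h; move/eqP/setP/(_ x): d2; rewrite !inE xj h.
    have -> // : x \in S j = false.
    by apply/negP => h; move/eqP/setP/(_ x): d1; rewrite !inE xi h.
Qed.

(** * Peeling families without large matchings *)

(** As [f] may repeat values, such a family cannot contain the empty set. *)
Definition matching_free (X : finType) k (T : {set {set X}}) :=
  forall f : 'I_k -> {set X}, (forall i, f i \in T) ->
  exists i j, i != j /\ ~~ [disjoint f i & f j].

Definition covered (X I : finType) (F : {set I}) (g : I -> {set X}) (T : {set {set X}}) :=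
  [set a in F | [exists S in T, S \subset g a]].

Definition above (X : finType) (W : {set {set X}}) (P : {set X}) :=
  [set S in W | P \subset S].

Lemma matching_free_sub (X : finType) k (T U : {set {set X}}) :
  U \subset T -> matching_free k T -> matching_free k U.
Proof. by move=> UT mT f fU; apply: mT => i; apply: (subsetP UT). Qed.

(* In a large uniform family, a maximal kernel [P] of overly large degree has
   small codegrees, so [P] can be extended inside the family around any given
   small set. *)
Lemma kernel_exists (X : finType) (W : {set {set X}}) m alpha :
  (forall S, S \in W -> #|S| = m) -> alpha ^ m < #|W| ->
  exists2 P : {set X}, #|P| < m & above W P != set0 /\
    forall Y : {set X}, [disjoint P & Y] -> #|Y| <= alpha ->
      exists2 S, S \in above W P & [disjoint S & Y].
Proof.
move=> Wm Wbig.
(* At size m the threshold is 1, while only one set lies above [P]; hence a maximal heavy set is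
   smaller than m. *)
pose heavy (P : {set X}) := (#|P| <= m) && (alpha ^ (m - #|P|) < #|above W P|).
have heavy0 : heavy set0.
  rewrite /heavy cards0 subn0 /= (_ : above W set0 = W) //.
  by apply/setP => S; rewrite inE sub0set andbT.
case: (@arg_maxnP _ set0 heavy (fun P => #|P|) heavy0) => P /andP[Pm Pbig] Pmax.
have {}Pm : #|P| < m.
  rewrite ltn_neqAle Pm andbT; apply/eqP => e; move: Pbig; rewrite e subnn expn0.
  rewrite ltnNge -(cards1 P) subset_leq_card //; apply/subsetP => S; rewrite !inE => /andP[SW PS].
  by rewrite eq_sym eqEcard PS e (Wm S SW) leqnn.
exists P => //; split; first by rewrite -card_gt0; apply: leq_ltn_trans Pbig.
move=> Y dPY Ya.
have [/exists_inP[S SW dS]|] := boolP [exists S in above W P, [disjoint S & Y]].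
  by exists S.
rewrite negb_exists => /forallP hit.
(* If every set above [P] met [Y], some [y |: P] would be heavy, against maximality. *)
have : #|above W P| <= \sum_(y in Y) #|above W (y |: P)|.
  apply: leq_trans (leq_card_bigcup _ _).
  apply/subset_leq_card/subsetP => S SW; have := hit S; rewrite SW /=.
  rewrite -setI_eq0 => /set0Pn[y]; rewrite inE => /andP[yS yY].
  apply/bigcupP; exists y => //; move: SW; rewrite !inE => /andP[-> PS].
  by rewrite subUset sub1set yS PS.
rewrite leqNgt => /negP[]; apply: leq_ltn_trans Pbig.
have -> : m - #|P| = (m - #|P|.+1).+1 by lia.
rewrite expnS; apply: leq_trans (_ : #|Y| * alpha ^ (m - #|P|.+1) <= _); last first.
  by rewrite leq_mul2r Ya orbT.
rewrite -sum_nat_const; apply: leq_sum => y yY.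
have yP : y \notin P.
  by move: dPY; rewrite disjoint_sym disjoint_subset => /subsetP/(_ y yY).
have cy : #|y |: P| = #|P|.+1 by rewrite cardsU1 yP.
rewrite leqNgt; apply/negP => big; have := Pmax (y |: P).
by rewrite /heavy cy Pm big /= => /(_ isT); rewrite /= ltnn.
Qed.

(** In a matching using [P], each occurrence of [P] can be exchanged for a member of [T] that avoids
    the other u sets, whose union has at most u * m points. Repeating this gives a matching inside
    [T]. *)
Lemma matching_free_kernel (X : finType) u m (T : {set {set X}}) (P : {set X}) :
  (forall S, S \in T -> #|S| <= m) -> #|P| <= m ->
  (forall Y : {set X}, [disjoint P & Y] -> #|Y| <= u * m ->
      exists2 S, S \in T & [disjoint S & Y]) ->
  matching_free u.+1 T -> matching_free u.+1 (P |: T).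
Proof.
move=> Tm Pm ext mT f fT.
have [/existsP[i /existsP[j /andP[ij d]]]|dis] :=
  boolP [exists i, exists j, (i != j) && ~~ [disjoint f i & f j]]; first by exists i, j.
have {}dis i j : i != j -> [disjoint f i & f j].
  move=> ij; apply: contraNT dis => d; apply/existsP; exists i; apply/existsP; exists j.
  by rewrite ij d.
exfalso; move: fT dis.
have [b] := ubnP #|[set i | f i \notin T]|.
elim: b f => // b IH f cb fT dis.
have [/existsP[i iT]|] := boolP [exists i, f i \notin T]; last first.
  rewrite negb_exists => /forallP fT'.
  have [|i [j [ij]]] := mT f; first by move=> i; have := fT' i; rewrite negbK.
  by rewrite dis.
have fiP : f i = P by have := fT i; rewrite !inE (negbTE iT) orbF => /eqP.
pose Y := \bigcup_(j | j != i) f j.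
have fY (S : {set X}) : [disjoint S & Y] -> forall j, j != i -> [disjoint S & f j].
  by move=> dS j ji; apply: disjointWr dS; apply: bigcup_sup.
have [||S ST dS] := ext Y.
- rewrite -fiP -setI_eq0; apply/eqP/setP => x; rewrite !inE; apply/negP => /andP[xi].
  case/bigcupP => j ji xj; have := dis i j; rewrite eq_sym => /(_ ji).
  by rewrite disjoint_subset => /subsetP/(_ x xi); rewrite inE xj.
- apply: leq_trans (leq_card_bigcup _ _) _.
  apply: leq_trans (_ : \sum_(j < u.+1 | j != i) m <= _).
    by apply: leq_sum => j _; have := fT j; rewrite inE => /orP[/set1P ->|/Tm].
  rewrite sum_nat_const (_ : #|_| = #|predC1 i|) ?cardC1 ?card_ord //.
pose f' j := if j == i then S else f j.
apply: (IH f').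
- rewrite -ltnS; apply: leq_trans cb; rewrite ltnS; apply: proper_card; apply/properP; split.
    apply/subsetP => j; rewrite !inE /f'; case: eqP => // _; by rewrite ST.
  by exists i; rewrite !inE ?iT // /f' eqxx ST.
- by move=> j; rewrite /f'; case: eqP => // _; rewrite inE ST orbT.
- move=> j1 j2 ij; rewrite /f'; case: (eqVneq j1 i) => [e1|n1]; case: (eqVneq j2 i) => [e2|n2].
  + by rewrite e1 e2 eqxx in ij.
  + exact: fY.
  + by rewrite disjoint_sym; apply: fY.
  + exact: dis.
Qed.

Lemma card_covered_singletons (X I : finType) (F : {set I}) (g : I -> {set X})
    (c1 u : nat) (T : {set {set X}}) :
  (forall S : {set X}, #|S| = 1 -> #|[set a in F | S \subset g a]| <= c1) ->
  (forall S, S \in T -> #|S| <= 1) -> matching_free u.+1 T ->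
  #|covered F g T| <= u * c1.
Proof.
move=> Fc T1 mT.
have T0 : set0 \notin T.
  apply/negP => T0; have [//|i [j [_]]] := mT (fun=> set0) _.
  by rewrite -setI_eq0 setI0 eqxx.
have {}T1 S : S \in T -> #|S| = 1.
  move=> ST; have := T1 S ST; rewrite leq_eqVlt => /orP[/eqP //|].
  by rewrite ltnS leqn0 cards_eq0 => /eqP S0; rewrite -S0 ST in T0.
have cT : #|T| <= u.
  rewrite leqNgt; apply/negP => uT.
  have [|i [j [ij]]] := mT (fun i => enum_val (widen_ord uT i)); first by move=> i; apply: enum_valP.
  have /eqP/cards1P[x ex] := T1 _ (enum_valP (widen_ord uT i)).
  have /eqP/cards1P[y ey] := T1 _ (enum_valP (widen_ord uT j)).
  rewrite ex ey disjoints1 inE negbK => /eqP xy.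
  have : widen_ord uT i = widen_ord uT j by apply: enum_val_inj; rewrite ex ey xy.
  by move/(congr1 val) => /= e; case/eqP: ij; apply: val_inj.
apply: leq_trans (_ : \sum_(S in T) #|[set a in F | S \subset g a]| <= _).
  apply: leq_trans (leq_card_bigcup _ _); apply/subset_leq_card/subsetP => a.
  rewrite inE => /andP[aF /exists_inP[S ST Sg]].
  by apply/bigcupP; exists S => //; rewrite inE aF.
apply: leq_trans (_ : \sum_(S in T) c1 <= _); first by apply: leq_sum => S /T1/Fc.
by rewrite sum_nat_const leq_mul2r cT orbT.
Qed.

(** Induction on the largest size. While more than (uj)^j sets have the largest size j, all those
    above a kernel [P] are replaced by [P]: coverage does not shrink, no matching appears, and the
    number of top sets drops. The remaining top sets are discarded at cost c(j) each. *)
Lemma card_covered_le (X I : finType) (F : {set I}) (g : I -> {set X})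
    (c : nat -> nat) u m (T : {set {set X}}) :
  (forall S : {set X}, #|[set a in F | S \subset g a]| <= c #|S|) ->
  (forall S, S \in T -> #|S| <= m.+1) -> matching_free u.+1 T ->
  #|covered F g T| <= u * c 1 + \sum_(2 <= j < m.+2) (u * j) ^ j * c j.
Proof.
move=> Fc; elim: m T => [|m IH] T Tm mT.
  rewrite big_geq // addn0; apply: card_covered_singletons mT => // S S1.
  by rewrite -S1.
pose top (T : {set {set X}}) := [set S in T | #|S| == m.+2].
have [b] := ubnP #|top T|; elim: b T Tm mT => // b IHb T Tm mT cb.
have [small|big] := leqP #|top T| ((u * m.+2) ^ m.+2).
  pose T0 := [set S in T | #|S| <= m.+1].
  have h : #|covered F g T| <= #|covered F g T0| + \sum_(S in top T) c m.+2.
    apply: leq_trans (_ : #|covered F g T0 :|: \bigcup_(S in top T) [set a in F | S \subset g a]| <= _).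
      apply/subset_leq_card/subsetP => a.
      rewrite inE => /andP[aF /exists_inP[S ST Sg]]; rewrite inE.
      have := Tm S ST; rewrite leq_eqVlt => /orP[Sm|Sm]; apply/orP; [right|left].
        by apply/bigcupP; exists S; rewrite inE ?ST // aF.
      by rewrite inE aF; apply/exists_inP; exists S => //; rewrite inE ST.
    apply: leq_trans (leq_card_setU _ _) _; rewrite leq_add2l.
    apply: leq_trans (leq_card_bigcup _ _) _; apply: leq_sum => S.
    by rewrite inE => /andP[_ /eqP <-].
  apply: leq_trans h _; rewrite sum_nat_const big_nat_recr //= addnA.
  apply: leq_add; last by rewrite leq_mul2r small orbT.
  apply: IH; first by move=> S; rewrite inE => /andP[].
  by apply: matching_free_sub mT; apply/subsetP => S; rewrite inE => /andP[].
have topm S : S \in top T -> #|S| = m.+2 by rewrite inE => /andP[_ /eqP].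
have [P Pm [W0 ext]] := kernel_exists topm big.
pose T1 := P |: (T :\: above (top T) P).
have mPT : matching_free u.+1 (P |: T).
  apply: (@matching_free_kernel _ _ m.+2) mT => //; first exact: ltnW.
  move=> Y dY cY; have [S SW dS] := ext Y dY cY; exists S => //.
  by move: SW; rewrite !inE => /andP[/andP[]].
apply: leq_trans (IHb T1 _ _ _).
- apply/subset_leq_card/subsetP => a; rewrite !inE => /andP[-> /exists_inP[S ST Sg]] /=.
  have [SW|SW] := boolP (S \in above (top T) P).
    apply/exists_inP; exists P; first by rewrite !inE eqxx.
    by move: SW; rewrite inE => /andP[_ PS]; apply: subset_trans Sg.
  by apply/exists_inP; exists S => //; rewrite !in_setU in_setD SW ST orbT.
- move=> S; rewrite in_setU1 => /orP[/eqP ->|]; first exact: ltnW.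
  by rewrite in_setD => /andP[_ /Tm].
- by apply: matching_free_sub mPT; apply: setUS; apply: subsetDl.
- rewrite -ltnS; apply: leq_trans cb; rewrite ltnS; apply: proper_card; apply/properP; split.
    apply/subsetP => S; rewrite [S \in top T1]inE in_setU1 => /andP[/orP[/eqP e|ST] Sm].
      by rewrite e (ltn_eqF Pm) in Sm.
    by move: ST; rewrite in_setD [S \in top T]inE Sm => /andP[_ ->].
  have /set0Pn[S SW] := W0; exists S; first by move: SW; rewrite inE => /andP[].
  rewrite [S \in top T1]inE in_setU1 in_setD SW /= orbF.
  apply/negP => /andP[/eqP e /eqP Sm]; move: Pm; rewrite -e Sm ltnn //.
Qed.

(** * Graphs of permutations *)

Definition gr n (s : {perm 'I_n}) : {set 'I_n * 'I_n} := [set p | s p.1 == p.2].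

Definition star n (F : {set {perm 'I_n}}) (S : {set 'I_n * 'I_n}) :=
  [set s in F | S \subset gr s].

Lemma card_gr n (s : {perm 'I_n}) : #|gr s| = n.
Proof.
rewrite -[RHS]card_ord -cardsT -(@card_imset _ _ (fun i => (i, s i))); last by move=> i j [].
apply: eq_card => -[x y]; rewrite !inE /=; apply/eqP/imsetP => [<-|[i _ [-> ->]] //].
by exists x.
Qed.

Lemma disjoint_gr n (s t : {perm 'I_n}) : [disjoint gr s & gr t] = ~~ intersecting s t.
Proof.
rewrite -setI_eq0 /intersecting; apply/eqP/existsPn => [/setP st i|st].
  by have := st (i, s i); rewrite !inE eqxx /= eq_sym => ->.
apply/setP => -[i y]; rewrite !inE /=; apply/negP => /andP[/eqP <- /eqP e].
by have := st i; rewrite e eqxx.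
Qed.

(** Right translation by [s0] reduces to permutations fixing [U] pointwise. *)
Lemma card_perm_agree n (s0 : {perm 'I_n}) (U : {set 'I_n}) :
  #|[set s : {perm 'I_n} | [forall i in U, s i == s0 i]]| = (n - #|U|)`!.
Proof.
have -> : n - #|U| = #|~: U| by rewrite [RHS]cardsCs setCK card_ord.
rewrite -card_perm -[RHS]cardsE -[RHS](@card_imset _ _ (fun u => (u * s0)%g)); last exact: mulIg.
apply: eq_card => s; rewrite !inE; apply/forall_inP/imsetP => [h|[u]].
  exists (s * s0^-1)%g; last by rewrite mulgKV.
  rewrite inE; apply/subsetP => x; rewrite !inE permM; apply: contra => /h/eqP ->.
  by rewrite permK.
rewrite inE => /subsetP uU -> x xU; rewrite permM.
have [-> //|ux] := eqVneq (u x) x.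
by have := uU x ux; rewrite inE xU.
Qed.

Lemma card_star n (F : {set {perm 'I_n}}) S : #|star F S| <= (n - #|S|)`!.
Proof.
have [->|/set0Pn[s0]] := eqVneq (star F S) set0; first by rewrite cards0.
rewrite inE => /andP[_ /subsetP S0].
pose U := [set p.1 | p in S].
have -> : #|S| = #|U|.
  rewrite card_in_imset // => -[x y] [x' y'] /S0 + /S0; rewrite !inE /=.
  by move=> /eqP <- /eqP <- ->.
rewrite -(card_perm_agree s0); apply/subset_leq_card/subsetP => s.
rewrite !inE => /andP[_ /subsetP Ss]; apply/forall_inP => x /imsetP[[x' y] xS -> /=].
by have := Ss _ xS; have := S0 _ xS; rewrite !inE /= => /eqP -> /eqP ->.
Qed.

(** Needed separately because truncated subtraction makes the factorial bound equal to 1 here. *)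
Lemma star_eq0 n (F : {set {perm 'I_n}}) (S : {set 'I_n * 'I_n}) : n < #|S| -> star F S = set0.
Proof.
move=> nS; apply/eqP; rewrite -subset0; apply/subsetP => s; rewrite inE => /andP[_ /subset_leq_card].
by rewrite card_gr leqNgt nS.
Qed.

Lemma star_star n (F : {set {perm 'I_n}}) (S Z : {set 'I_n * 'I_n}) :
  star (star F S) Z = star F (S :|: Z).
Proof. by apply/setP => s; rewrite !inE subUset -andbA. Qed.

(** Take [S] maximal of size at most q with star larger than R^(q-|S|) (n-q)!. Adding [Z] either
    stays within size q, where maximality bounds the star, or exceeds q, where the factorial bound
    on any star suffices. *)
Lemma spread_star_exists n (F : {set {perm 'I_n}}) R q :
  q <= n -> 4 * R <= n - q -> R ^ q * (n - q)`! < #|F| ->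
  exists S : {set 'I_n * 'I_n}, [/\ #|S| <= q, star F S != set0 &
    forall Z : {set 'I_n * 'I_n}, [disjoint Z & S] ->
      #|star (star F S) Z| * R ^ #|Z| <= #|star F S|].
Proof.
move=> qn Rn Fbig.
pose heavy (S : {set 'I_n * 'I_n}) := (#|S| <= q) && (R ^ (q - #|S|) * (n - q)`! < #|star F S|).
have heavy0 : heavy set0.
  rewrite /heavy cards0 subn0 /= (_ : star F set0 = F) //.
  by apply/setP => s; rewrite inE sub0set andbT.
case: (@arg_maxnP _ set0 heavy (fun S => #|S|) heavy0) => S /andP[Sq Sbig] Smax.
exists S; split=> //; first by rewrite -card_gt0; apply: leq_ltn_trans Sbig.
move=> Z dZS; rewrite star_star; set U := S :|: Z.
have [->|Z0] := posnP #|Z|.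
  rewrite muln1 /U; apply/subset_leq_card/subsetP => s; rewrite !inE => /andP[-> /=].
  by rewrite subUset => /andP[].
have cU : #|U| = #|S| + #|Z|.
  rewrite /U cardsU (_ : S :&: Z = set0) ?cards0 ?subn0 //.
  by apply/eqP; rewrite setI_eq0 disjoint_sym.
apply: leq_trans (ltnW Sbig).
have [Uq|qU] := leqP #|U| q.
  have : ~~ heavy U.
    apply/negP => /Smax /=; rewrite cU leqNgt => /negP; apply; rewrite -addn1 leq_add2l; exact: Z0.
  rewrite /heavy Uq /= -leqNgt => le.
  apply: leq_trans (leq_mul le (leqnn _)) _.
  have -> : q - #|S| = q - #|U| + #|Z| by lia.
  by rewrite expnD mulnAC.
have [nU|Un] := ltnP n #|U|; first by rewrite star_eq0 // cards0.
apply: leq_trans (leq_mul (card_star F U) (leqnn _)) _.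
have -> : #|Z| = (q - #|S|) + (#|U| - q) by lia.
rewrite expnD mulnCA leq_mul2l; apply/orP; right; rewrite mulnC.
have := @expn_fact_le R (n - q) (#|U| - q).
have -> : n - q - (#|U| - q) = n - #|U| by lia.
by apply=> //; lia.
Qed.

(** * Permutations avoiding forbidden positions *)

(** [Q i] is the set of values forbidden in row [i]. *)
Definition hits n (Q : 'I_n -> {set 'I_n}) (s : {perm 'I_n}) := [set i | s i \in Q i].

Definition agree n (U : {set 'I_n}) (s0 : {perm 'I_n}) :=
  [set s : {perm 'I_n} | [forall i in U, s i == s0 i]].

Definition hit_level n (U : {set 'I_n}) (s0 : {perm 'I_n}) (Q : 'I_n -> {set 'I_n}) j :=
  [set s in agree U s0 | #|hits Q s| == j].

Lemma card_dep_pairs (S T : finType) (A : {set S}) (B : S -> {set T}) :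
  #|[set p : S * T | (p.1 \in A) && (p.2 \in B p.1)]| = \sum_(x in A) #|B x|.
Proof.
rewrite -sum1dep_card -(pair_big_dep (fun x => x \in A) (fun x y => y \in B x) (fun _ _ => 1)) /=.
by apply: eq_bigr => x _; rewrite sum1_card.
Qed.

(* Switching: exchanging a hit row [i] with a generic row [k] destroys exactly one hit. *)
Lemma hit_level_switch n (U : {set 'I_n}) (s0 : {perm 'I_n}) (Q : 'I_n -> {set 'I_n}) j :
  (forall i, #|Q i| <= 2) -> (forall y, #|[set i | y \in Q i]| <= 2) ->
  (forall i, i \in U -> s0 i \notin Q i) ->
  #|hit_level U s0 Q j.+1| * (j.+1 * (n - (#|U| + j.+1 + 4)))
    <= #|hit_level U s0 Q j| * (n * 2).
Proof.
move=> Qr Qc U0.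
(* Rows with which [i] must not be exchanged: prescribed rows, other hits, and rows where the
   exchange would create a hit. *)
pose bad (s : {perm 'I_n}) i := U :|: hits Q s :|: [set k | s k \in Q i] :|: [set k | s i \in Q k].
pose B (s : {perm 'I_n}) := [set p : 'I_n * 'I_n | (p.1 \in hits Q s) && (p.2 \in ~: bad s p.1)].
(* After the switch row [k] holds the old value of row [i], which lies in [Q i]; so at most two [k]
   are possible for each [i]. *)
pose B' (s : {perm 'I_n}) := [set p : 'I_n * 'I_n | (p.1 \in setT) && (p.2 \in [set k | s k \in Q p.1])].
pose P := [set p : {perm 'I_n} * ('I_n * 'I_n) | (p.1 \in hit_level U s0 Q j.+1) && (p.2 \in B p.1)].
pose P' := [set p : {perm 'I_n} * ('I_n * 'I_n) | (p.1 \in hit_level U s0 Q j) && (p.2 \in B' p.1)].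
have pre (s : {perm 'I_n}) i : #|[set k | s k \in Q i]| <= 2.
  have -> : [set k | s k \in Q i] = s @^-1: Q i by apply/setP => k; rewrite !inE.
  by rewrite card_preimset //; apply: perm_inj.
have leP : #|hit_level U s0 Q j.+1| * (j.+1 * (n - (#|U| + j.+1 + 4))) <= #|P|.
  rewrite card_dep_pairs -sum_nat_const; apply: leq_sum => s.
  rewrite inE => /andP[_ /eqP hs].
  rewrite (card_dep_pairs (hits Q s) (fun i => ~: bad s i)) -[X in X * _]hs -sum_nat_const; apply: leq_sum => i _.
  rewrite [X in _ <= X]cardsCs setCK card_ord leq_sub2l //.
  rewrite -[4]/(2 + 2) addnA /bad.
  apply: leq_trans (leq_card_setU _ _) _; apply: leq_add (Qc _).
  apply: leq_trans (leq_card_setU _ _) _; apply: leq_add (pre _ _).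
  by apply: leq_trans (leq_card_setU _ _) _; rewrite hs.
have geP : #|P'| <= #|hit_level U s0 Q j| * (n * 2).
  rewrite (card_dep_pairs _ B') -sum_nat_const; apply: leq_sum => s _.
  rewrite (card_dep_pairs setT (fun i => [set k | s k \in Q i])) -[X in X * 2]card_ord -cardsT -sum_nat_const; apply: leq_sum => i _.
  exact: pre.
apply: leq_trans leP (leq_trans _ geP).
pose h (p : {perm 'I_n} * ('I_n * 'I_n)) := ((tperm p.2.1 p.2.2 * p.1)%g, p.2).
rewrite -(@card_imset _ _ h); last first.
  by move=> [s1 p1] [s2 p2] [/= + e]; rewrite e => /mulgI ->.
apply/subset_leq_card/subsetP => r /imsetP[[s [i k]]]; rewrite inE => /andP[/=].
rewrite inE => /andP[sU /eqP hs]; rewrite inE => /andP[/= ih]; rewrite !inE !negb_or.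
move=> /andP[/andP[/andP[kU khit] skQi] siQk] ->.
have siQ : s i \in Q i by move: ih; rewrite inE.
have iU : i \notin U.
  apply/negP => iU; move: sU; rewrite inE => /forall_inP/(_ i iU)/eqP e.
  by have := U0 i iU; rewrite -e siQ.
have ki : k != i by apply: contraNneq khit => ->.
rewrite /h /= permM tpermR siQ !andbT; apply/andP; split.
  apply/forall_inP => x xU; move: sU; rewrite inE => /forall_inP/(_ x xU) sx.
  by rewrite permM tpermD //; [apply: contraNneq iU | apply: contraNneq kU] => ->.
rewrite (_ : hits Q _ = hits Q s :\ i).
  by have := cardsD1 i (hits Q s); rewrite ih hs => -[->].
apply/setP => x; rewrite !inE permM; case: tpermP => [->|->|/eqP xi /eqP xk].
- by rewrite eqxx (negbTE skQi).
- by rewrite ki /= (negbTE siQk) (negbTE khit).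
- by rewrite xi.
Qed.

(** The mean number of hits is at most 2: each row off [U] has at most two forbidden values, each
    taken with probability at most 1/(n-|U|). *)
Lemma sum_hits n (U : {set 'I_n}) (s0 : {perm 'I_n}) (Q : 'I_n -> {set 'I_n}) :
  (forall i, #|Q i| <= 2) -> (forall i, i \in U -> s0 i \notin Q i) ->
  \sum_(s in agree U s0) #|hits Q s| <= 2 * (n - #|U|)`!.
Proof.
move=> Qr U0.
apply: leq_trans (_ : \sum_(i in ~: U) 2 * (n - #|U|.+1)`! <= _); last first.
  rewrite sum_nat_const [#|~: U|]cardsCs setCK card_ord subnS.
  by case: (n - #|U|) => // m; rewrite factS /=; nia.
have e s : s \in agree U s0 -> #|hits Q s| = \sum_(i in ~: U) (s i \in Q i).
  rewrite inE => /forall_inP sU; rewrite -sum1_card [in RHS]big_mkcond [LHS]big_mkcond /=.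
  apply: eq_bigr => i _; rewrite !inE; case: (boolP (i \in U)) => iU /=; last by case: (s i \in Q i).
  by rewrite (eqP (sU i iU)) (negbTE (U0 i iU)).
rewrite (eq_bigr _ e) exchange_big /=; apply: leq_sum => i; rewrite inE => iU.
have -> : \sum_(s in agree U s0) (s i \in Q i) =
          \sum_(y in Q i) #|[set s in agree U s0 | s i == y]|.
  rewrite -big_mkcondr /= sum1dep_card -sum1dep_card.
  rewrite (partition_big (fun s : {perm 'I_n} => s i) (fun y => y \in Q i)) /=; last first.
    by move=> s /andP[].
  apply: eq_bigr => y yQ; rewrite sum1dep_card; apply: eq_card => s; rewrite !inE.
  by case: eqP => [->|_]; rewrite ?yQ ?andbT ?andbF.
apply: leq_trans (_ : \sum_(y in Q i) (n - #|U|.+1)`! <= _); last first.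
  by rewrite sum_nat_const leq_mul2r Qr orbT.
apply: leq_sum => y _.
have [->|/set0Pn[s1]] := eqVneq [set s in agree U s0 | s i == y] set0; first by rewrite cards0.
rewrite inE => /andP[]; rewrite inE => /forall_inP s1U /eqP s1i.
have -> : #|U|.+1 = #|i |: U| by rewrite cardsU1 iU.
rewrite -(card_perm_agree s1); apply/subset_leq_card/subsetP => s; rewrite !inE.
move=> /andP[/forall_inP sU /eqP si]; apply/forall_inP => x; rewrite !inE => /orP[/eqP ->|xU].
  by rewrite si s1i.
by rewrite (eqP (sU x xU)) (eqP (s1U x xU)).
Qed.

(** As the mean number of hits is at most 2, at least a third of the permutations have at most two
    hits. Switching gives N1 <= 2.02 N0 and N2 <= 1.01 N1, and 3(1 + 2.02 + 2.05) < 16. *)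
Lemma card_avoid n (U : {set 'I_n}) (s0 : {perm 'I_n}) (Q : 'I_n -> {set 'I_n}) :
  2 ^ 10 <= n -> #|U| <= 2 ->
  (forall i, #|Q i| <= 2) -> (forall y, #|[set i | y \in Q i]| <= 2) ->
  (forall i, i \in U -> s0 i \notin Q i) ->
  (n - #|U|)`! <= 16 * #|hit_level U s0 Q 0|.
Proof.
move=> nbig U2 Qr Qc U0.
have h1 := hit_level_switch 0 Qr Qc U0.
have h2 := hit_level_switch 1 Qr Qc U0.
have hs := sum_hits Qr U0.
have cG : #|agree U s0| = (n - #|U|)`! by apply: card_perm_agree.
set N0 := #|hit_level U s0 Q 0| in h1 *.
set N1 := #|hit_level U s0 Q 1| in h1 h2.
set N2 := #|hit_level U s0 Q 2| in h2.
rewrite -cG in hs *.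
have hg : 3 * #|agree U s0| <= 3 * (N0 + N1 + N2) + \sum_(s in agree U s0) #|hits Q s|.
  have -> : N0 + N1 + N2 = \sum_(s in agree U s0) (#|hits Q s| <= 2).
    rewrite /N0 /N1 /N2 -!sum1dep_card !big_mkcondr -!big_split /=.
    by apply: eq_bigr => s _; case: #|hits Q s| => [|[|[|m]]].
  rewrite big_distrr -big_split mulnC -sum_nat_const; apply: leq_sum => s _ /=.
  by case: leqP; lia.
have {}nbig : 1000 <= n by apply: leq_trans nbig.
have e1 : 100 * n <= 101 * (n - 8) by lia.
have {}h1 : N1 * (n - 8) <= 2 * n * N0.
  apply: leq_trans (_ : N1 * (1 * (n - (#|U| + 1 + 4))) <= _); last by lia.
  by rewrite mul1n leq_mul2l; apply/orP; right; lia.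
have {}h2 : N2 * (n - 8) <= n * N1.
  have : N2 * (2 * (n - 8)) <= N2 * (2 * (n - (#|U| + 2 + 4))).
    by rewrite leq_mul2l; apply/orP; right; lia.
  by move: h2; lia.
have n8 : 0 < n - 8 by lia.
have f1 : 100 * N1 <= 202 * N0.
  rewrite -(leq_pmul2r n8); have := leq_mul e1 (leqnn (2 * N0)); lia.
have f2 : 100 * N2 <= 101 * N1.
  rewrite -(leq_pmul2r n8); have := leq_mul e1 (leqnn N1); lia.
by lia.
Qed.

(** * Stars of derangements *)

Lemma perm_two_points n (x x' y y' : 'I_n) :
  x != x' -> y != y' -> exists g : {perm 'I_n}, g x = y /\ g x' = y'.
Proof.
move=> xx yy; exists (tperm x y * tperm (tperm x y x') y')%g; rewrite !permM tpermL.
split; last by rewrite tpermL.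
have h : tperm x y x' != y by rewrite -{2}(tpermL x y) (inj_eq perm_inj) eq_sym.
by apply: tpermD; rewrite // eq_sym.
Qed.

Lemma Dpair_star n (x y : 'I_n) : Dpair x y = star (Dn n) [set (x, y)].
Proof. by apply/setP => s; rewrite !inE sub1set inE. Qed.

(** Conjugation preserves derangements and carries any off-diagonal pair to any other. *)
Lemma leq_card_Dpair n (x y x' y' : 'I_n) :
  x != y -> x' != y' -> #|Dpair x y| <= #|Dpair x' y'|.
Proof.
move=> xy xy'; have [g [gx gy]] := perm_two_points xy xy'.
rewrite -(@card_imset _ _ (fun s => (s ^ g)%g)); last exact: conjg_inj.
apply/subset_leq_card/subsetP => t /imsetP[s]; rewrite inE => /andP[/forallP ds /eqP sx] ->.
rewrite inE -gx permJ sx gy eqxx andbT; apply/forallP => i.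
by rewrite -[i](permKV g) permJ (inj_eq perm_inj).
Qed.

Lemma card_Dpair n (x y : 'I_n) : x != y -> #|Dpair x y| = d_n1 n.
Proof.
case: n x y => [|[|n]] x y xy; first by case: x xy.
  by rewrite !ord1 eqxx in xy.
pose o1 : 'I_n.+2 := lift ord0 ord0.
have -> : d_n1 n.+2 = #|Dpair ord0 o1|.
  apply: eq_card => s; rewrite !inE; congr (_ && _).
  apply/existsP/eqP => [[i /andP[/eqP i0 /eqP s1]]|s0].
    have -> : ord0 = i by apply: val_inj.
    exact: val_inj.
  by exists ord0; rewrite s0.
by apply/eqP; rewrite eqn_leq !leq_card_Dpair.
Qed.

Lemma card_Dpair_avoid n (x y : 'I_n) (t : {perm 'I_n}) :
  2 ^ 10 <= n -> x != y -> t x != y ->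
  n.-1`! <= 16 * #|[set s in Dpair x y | [disjoint gr s & gr t]]|.
Proof.
move=> nbig xy txy.
(* Forbidding [i] makes a derangement, forbidding [t i] makes it disjoint from [t]; the
   transposition only prescribes the value [y] at [x]. *)
have := @card_avoid n [set x] (tperm x y) (fun i => [set i; t i]) nbig.
rewrite cards1 subn1 => h; apply: leq_trans (h _ _ _ _) _ => {h} //.
- by move=> i; rewrite cards2; case: (_ != _).
- move=> z; apply: leq_trans (_ : #|[set z; (t^-1)%g z]| <= _); last by rewrite cards2; case: (_ != _).
  apply/subset_leq_card/subsetP => i; rewrite !inE => /orP[/eqP ->|/eqP ->]; first by rewrite eqxx.
  by rewrite permK eqxx orbT.
- by move=> i; rewrite inE => /eqP ->; rewrite tpermL !inE negb_or eq_sym xy eq_sym.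
rewrite leq_mul2l; apply/subset_leq_card/subsetP => s; rewrite !inE.
move=> /andP[/forall_inP/(_ x (set11 x)) sx /eqP/cards0_eq/setP h0].
have h i : (s i != i) && (s i != t i) by have := h0 i; rewrite !inE -negb_or => ->.
rewrite tpermL in sx; rewrite sx andbT disjoint_gr; apply/andP; split.
  by apply/forallP => i; case/andP: (h i).
by rewrite negb_exists; apply/forallP => i; case/andP: (h i).
Qed.

Lemma Dpair_meet n (x y x' y' : 'I_n) :
  2 ^ 10 <= n -> x != y -> x' != y' -> x != x' -> y != y' ->
  exists s, (s \in Dpair x y) && (s \in Dpair x' y').
Proof.
move=> nbig xy xy' xx yy; have [g [gx gy]] := perm_two_points xx yy.
have := @card_avoid n [set x; x'] g (fun i => [set i]) nbig.
rewrite cards2 xx => /(_ isT) h.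
have : 0 < #|hit_level [set x; x'] g (fun i => [set i]) 0|.
  rewrite -(@ltn_pmul2l 16) // muln0; apply: leq_trans (h _ _ _); first exact: fact_gt0.
  - by move=> i; rewrite cards1.
  - move=> z; rewrite (_ : [set _ | _] = [set z]) ?cards1 //.
    by apply/setP => i; rewrite !inE eq_sym.
  - by move=> i; rewrite !inE => /orP[] /eqP ->; rewrite ?gx ?gy eq_sym.
move=> /card_gt0P[s]; rewrite !inE => /andP[/forall_inP sU /eqP/cards0_eq/setP h0].
exists s; rewrite !inE.
have -> : derangement s by apply/forallP => i; have := h0 i; rewrite !inE => ->.
by rewrite -gx -gy !sU // !inE eqxx ?orbT.
Qed.

Lemma leq_nu n (J : finType) (F : {set {perm 'I_n}}) (a : J -> {perm 'I_n}) :
  0 < n -> (forall i, a i \in F) -> (forall i j, i != j -> [disjoint gr (a i) & gr (a j)]) ->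
  #|J| <= nu F.
Proof.
move=> n0 aF da.
have ainj : injective a.
  move=> i j e; apply/eqP; apply: contraT => /da; rewrite e -setI_eq0 setIid -cards_eq0.
  by rewrite card_gr eqn0Ngt n0.
rewrite -cardsT -(card_imset _ ainj).
apply: (@bigmax_sup _ (a @: setT)) => //.
apply/andP; split; first by apply/subsetP => s /imsetP[i _ ->]; apply: aF.
apply/forall_inP => s /imsetP[i _ ->]; apply/forall_inP => t /imsetP[j _ ->].
by apply/implyP => ij; rewrite -disjoint_gr; apply: da; apply: contraNneq ij => ->.
Qed.

(** The star of [Z] in [G] has at most (n-1-|Z|)! <= (n-1)!/(24R)^|Z| members; since [Z] is
    nonempty, one factor 24 pays for the density of [G]. *)
Lemma dense_star_spread n (G : {set {perm 'I_n}}) (e : 'I_n * 'I_n) R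
    (Z : {set 'I_n * 'I_n}) :
  4 * (24 * R) <= n.-1 -> n.-1`! <= 24 * #|G| ->
  (forall s, s \in G -> [set e] \subset gr s) ->
  Z != set0 -> [disjoint Z & [set e]] ->
  #|star G Z| * R ^ #|Z| <= #|G|.
Proof.
move=> Rn Gbig Ge Z0 dZ.
have eZ : e \notin Z by rewrite disjoint_sym disjoints1 in dZ.
have sE : star G Z = star G (e |: Z).
  by apply/setP => s; rewrite !inE subUset; case: (boolP (s \in G)) => //= /Ge ->.
have [nZ|Zn] := ltnP n #|e |: Z|; first by rewrite sE star_eq0 // cards0.
have := card_star G (e |: Z); rewrite -sE cardsU1 eZ add1n => le.
rewrite cardsU1 eZ add1n in Zn.
have := @expn_fact_le (24 * R) n.-1 #|Z|.
have -> : n.-1 - #|Z| = n - #|Z|.+1 by lia.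
move=> /(_ _ Rn); rewrite -ltnS => /(_ (leq_trans Zn (leqSpred n))) le2.
have := leq_trans le2 Gbig; rewrite expnMn.
have [z zE] : exists z, #|Z| = z.+1.
  by move: Z0; rewrite -card_gt0; case: #|Z| => // z _; exists z.
rewrite zE [24 ^ _]expnS -!mulnA leq_pmul2l // => le3.
apply: leq_trans le3; rewrite -zE mulnC.
apply: leq_trans (leq_pmull _ (expn_gt0 24 z)).
by rewrite leq_mul2l le orbT.
Qed.

(** * Lower order terms, spread kernels and disjoint systems *)

Lemma sum_geometric_le (x : nat -> nat) K m :
  (forall j, 2 <= j < m.+2 -> x j * 2 ^ j.-1 <= K) -> \sum_(2 <= j < m.+2) x j <= K.
Proof.
move=> xK.
(* The sum is at most K(1 - 2^-m), a form that passes through the induction. *)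
suff h : (\sum_(2 <= j < m.+2) x j) * 2 ^ m + K <= K * 2 ^ m.
  by rewrite -(@leq_pmul2r (2 ^ m)) ?expn_gt0 //; apply: leq_trans h; apply: leq_addr.
elim: m xK => [|m IH] xK; first by rewrite big_geq // mul0n muln1.
rewrite big_nat_recr //= mulnDl expnS.
have := xK m.+2; rewrite !leqnn /= => /(_ isT); rewrite expnS.
have : (\sum_(2 <= j < m.+2) x j) * 2 ^ m + K <= K * 2 ^ m.
  by apply: IH => j /andP[j2 jm]; apply: xK; rewrite j2 leqW.
lia.
Qed.

(** The term of index j is uj times (uj)^(j-1) (n-j)!, hence at most uj (n-1)!/2^(13(j-1)). With j
    <= 2^(j-1) this decays geometrically and leaves the factor 2^11. *)
Lemma kernel_tail_le n u l :
  0 < l -> 2 ^ 16 * (u * l) <= n ->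
  2 ^ 11 * (\sum_(2 <= j < l.+1) (u * j) ^ j * (n - j)`!) <= u * n.-1`!.
Proof.
case: l => // m _ ul; rewrite big_distrr /=; apply: sum_geometric_le => j /andP[j2 jm].
have [->|u0] := posnP u; first by case: j j2 {jm} => // j _; rewrite mul0n exp0n // mul0n muln0.
have uj : 2 ^ 16 * (u * j) <= n by apply: leq_trans ul; rewrite !leq_mul2l -ltnS jm !orbT.
case: j j2 jm uj => [|[|i]] // _ _ uj.
have := @expn_fact_le (2 ^ 13 * (u * i.+2)) n.-1 i.+1.
have -> : n.-1 - i.+1 = n - i.+2 by lia.
move=> h; have {h} : (2 ^ 13 * (u * i.+2)) ^ i.+1 * (n - i.+2)`! <= n.-1`!.
  have e16 : 2 ^ 16 = 65536 by [].
  have e13 : 2 ^ 13 = 8192 by [].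
  have w : i.+2 <= u * i.+2 by rewrite leq_pmull.
  by rewrite e16 in uj; rewrite e13 in h *; apply: h; lia.
set f := (n - i.+2)`!; set g := n.-1`!; rewrite expnMn => h.
rewrite [(u * i.+2) ^ i.+2]expnS /=; set y := (u * i.+2) ^ i.+1 in h *.
have z : 2 ^ 11 * 2 ^ i.+1 * i.+2 <= (2 ^ 13) ^ i.+1.
  have h1 : i.+2 <= 2 ^ i.+1 by apply: ltn_expl.
  apply: leq_trans (leq_mul (leqnn _) h1) _.
  by rewrite -!expnD -expnM leq_exp2l //; lia.
have := leq_mul (leqnn u) (leq_trans (leq_mul (leq_mul z (leqnn y)) (leqnn f)) _).
move=> /(_ g h); apply: leq_trans.
move: {h z uj ul} (2 ^ 11) (2 ^ i.+1) => a b; move: (i.+2) f y => c f y.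
by apply: eq_leq; lia.
Qed.

(** Kernels have logarithmic size for this reason: 2^l > n absorbs the quotient of n! by (n-1)!. *)
Lemma kernel_rest_le n l R :
  4 * (16 * R) <= n -> l <= n -> n < 2 ^ l -> 0 < n -> 8 ^ l * (R ^ l * (n - l)`!) <= n.-1`!.
Proof.
move=> Rn ln nl n0; have := expn_fact_le ln Rn.
rewrite expnMn -{2}(prednK n0) factS prednK // -[16]/(2 * 8) expnMn => h.
rewrite -(@leq_pmul2l (2 ^ l)) ?expn_gt0 // !mulnA; apply: leq_trans h _.
by rewrite leq_mul2r ltnW ?orbT.
Qed.

(** The spread family [G] is only a part of the star of [S], because kernels are found inside
    subfamilies of [F]. *)
Definition spread_kernels n (F : {set {perm 'I_n}}) R l : {set {set 'I_n * 'I_n}} :=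
  [set S : {set 'I_n * 'I_n} | (#|S| <= l) &&
    [exists G : {set {perm 'I_n}}, [&& G != set0, G \subset star F S &
      [forall Z : {set 'I_n * 'I_n}, [disjoint Z & S] ==> (#|star G Z| * R ^ #|Z| <= #|G|)]]]].

(** Were the uncovered part larger, it would contain a spread star of its own, whose kernel covers
    members supposed uncovered. *)
Lemma card_uncovered n (F : {set {perm 'I_n}}) R l :
  l <= n -> 4 * R <= n - l ->
  #|F :\: covered F (@gr n) (spread_kernels F R l)| <= R ^ l * (n - l)`!.
Proof.
move=> ln Rn; rewrite leqNgt; apply/negP => big.
have [S [Sl S0 sS]] := spread_star_exists ln Rn big.
set F' := F :\: _ in S0 sS.
have /set0Pn[s] := S0; rewrite inE => /andP[]; rewrite inE => /andP[ncov sF] Ss.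
case/negP: ncov; rewrite inE sF; apply/exists_inP; exists S => //.
rewrite inE Sl; apply/existsP; exists (star F' S); rewrite S0 /=; apply/andP; split.
  by apply/subsetP => t; rewrite !inE => /andP[/andP[_ ->] ->].
by apply/forallP => Z; apply/implyP => dZ; apply: sS.
Qed.

(** The index type is arbitrary, so that kernels, dense pairs and a single permutation can be
    combined later. *)
Lemma disjoint_system n s l (J : finType) (S : J -> {set 'I_n * 'I_n})
    (G : J -> {set {perm 'I_n}}) :
  0 < s -> 0 < l -> n < 2 ^ l -> 2 ^ 16 * (s * l) <= n -> #|J| <= s ->
  (forall j, #|S j| <= l) ->
  (forall i j, i != j -> [disjoint S i & S j]) ->
  (forall j, G j != set0) ->
  (forall j a, a \in G j -> S j \subset gr a) ->
  (forall j (Z : {set 'I_n * 'I_n}), Z != set0 -> [disjoint Z & S j] ->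
     #|star (G j) Z| * (2 ^ 9 * (s * l)) ^ #|Z| <= #|G j|) ->
  exists a : J -> {perm 'I_n}, (forall j, a j \in G j) /\
    forall i j, i != j -> [disjoint gr (a i) & gr (a j)].
Proof.
move=> s0 l0 nl sn Js Sl Sd G0 GS sG.
have ns : s <= n.
  by apply: leq_trans sn; rewrite mulnCA leq_pmulr // muln_gt0 expn_gt0.
have [|||i a|i|i j ij|i|i Z|a [aG da]] := @spread_disjoint_off _ _ #|J| l
    (fun i => S (enum_val i)) (fun i => G (enum_val i)) (@gr n) (2 ^ 8 * (s * l)).
- by rewrite leq_mul2l leq_mul2r Js !orbT.
- by rewrite !muln_gt0 s0 l0.
- exact: leq_ltn_trans Js (leq_ltn_trans ns nl).
- by move=> aG; rewrite card_gr; split=> //; apply: GS.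
- exact: Sl.
- by apply: Sd; rewrite (inj_eq enum_val_inj).
- exact: G0.
- by rewrite mulnA -expnS; apply: sG.
exists (fun j => a (enum_rank j)); split=> [j|i j ij].
  by have := aG (enum_rank j); rewrite enum_rankK.
by apply: da; rewrite (inj_eq enum_rank_inj).
Qed.

(** * Dense pairs *)

(** The defect 1/64 is large enough to dominate the lower order terms in [card_residual_lt], and
    small against the proportion 1/16 of [card_Dpair_avoid]. *)
Definition dense_pairs n (F : {set {perm 'I_n}}) : {set 'I_n * 'I_n} :=
  [set e | 63 * d_n1 n <= 64 * #|star F [set e]|].

Definition residual n (F : {set {perm 'I_n}}) : {set {perm 'I_n}} :=
  [set s in F | [disjoint dense_pairs F & gr s]].

(** Avoiding the identity is the same as being a derangement. *)
Lemma fact_le_d_n1 n : 2 ^ 10 <= n -> n.-1`! <= 16 * d_n1 n.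
Proof.
move=> nbig; case: n nbig => [|[|n]] // nbig.
pose o1 : 'I_n.+2 := lift ord0 ord0.
apply: leq_trans (card_Dpair_avoid nbig (_ : ord0 != o1) (t := 1%g) _) _; rewrite ?perm1 //.
rewrite leq_mul2l -(card_Dpair (_ : ord0 != o1)) //; apply/subset_leq_card/subsetP => s.
by rewrite inE => /andP[].
Qed.

Lemma d_n1_gt0 n : 2 ^ 10 <= n -> 0 < d_n1 n.
Proof. by move=> /fact_le_d_n1; have := fact_gt0 n.-1; lia. Qed.

Lemma star_sub_Dpair n (F : {set {perm 'I_n}}) x y :
  F \subset Dn n -> star F [set (x, y)] \subset Dpair x y.
Proof.
by move=> FD; rewrite Dpair_star; apply/subsetP => s; rewrite !inE => /andP[/(subsetP FD)+ ->];
  rewrite inE => ->.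
Qed.

Lemma dense_pair_offdiag n (F : {set {perm 'I_n}}) x y :
  2 ^ 10 <= n -> F \subset Dn n -> (x, y) \in dense_pairs F -> x != y.
Proof.
move=> nbig FD; rewrite inE => he; apply: contraTneq he => ->.
rewrite (_ : star F [set (y, y)] = set0) ?cards0; first by have := d_n1_gt0 nbig; lia.
apply/eqP; rewrite -subset0; apply: subset_trans (star_sub_Dpair _ _ FD) _.
apply/subsetP => s; rewrite inE => /andP[/forallP/(_ y) ds sy].
by rewrite sy in ds.
Qed.

Lemma card_star_le_d n (F : {set {perm 'I_n}}) e :
  2 ^ 10 <= n -> F \subset Dn n -> e \in dense_pairs F -> #|star F [set e]| <= d_n1 n.
Proof.
case: e => x y nbig FD he; rewrite -(card_Dpair (dense_pair_offdiag nbig FD he)).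
exact/subset_leq_card/star_sub_Dpair.
Qed.

Lemma card_star_dense n (F : {set {perm 'I_n}}) e :
  2 ^ 10 <= n -> e \in dense_pairs F -> n.-1`! <= 24 * #|star F [set e]|.
Proof. by move=> /fact_le_d_n1; rewrite inE; lia. Qed.

Lemma size_bounds n s l :
  0 < s -> 10 <= l -> 2 ^ 16 * (s * l) <= n ->
  [/\ 2 ^ 10 <= n, 0 < n, 4 * (24 * (2 ^ 9 * (s * l))) <= n.-1, l <= n
    & 4 * (16 * (2 ^ 9 * (s * l))) <= n - l].
Proof.
move=> s0 l10.
have : l <= s * l by rewrite leq_pmull.
rewrite (_ : 2 ^ 16 = 64 * 1024) // (_ : 2 ^ 10 = 1024) // (_ : 2 ^ 9 = 512) //.
by move: (s * l) => k kl kn; split; lia.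
Qed.

Lemma leq_nu_dense n s l (F : {set {perm 'I_n}}) :
  0 < s -> 10 <= l -> n < 2 ^ l -> 2 ^ 16 * (s * l) <= n -> nu F < s ->
  #|dense_pairs F| < s.
Proof.
move=> s0 l10 nl sn; apply: contraTT; rewrite -!leqNgt => sE.
have [nbig n0 Rn _ _] := size_bounds s0 l10 sn.
pose e (i : 'I_s) : 'I_n * 'I_n := enum_val (widen_ord sE i).
have eE i : e i \in dense_pairs F by apply: enum_valP.
have [||i|i j ij|i|i a|i Z Z0 dZ|a [aG da]] := @disjoint_system n s l 'I_s
    (fun i => [set e i]) (fun i => star F [set e i]) s0 _ nl sn.
- exact: leq_trans l10.
- by rewrite card_ord.
- by rewrite cards1; apply: leq_trans l10.
- rewrite disjoints1 inE; apply: contraNneq ij => /enum_val_inj h; apply/eqP/val_inj.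
  exact: (congr1 val h).
- by have := leq_trans (fact_gt0 n.-1) (card_star_dense nbig (eE i)); rewrite muln_gt0 card_gt0.
- by rewrite inE => /andP[].
- apply: (dense_star_spread Rn (card_star_dense nbig (eE i))) Z0 dZ => t.
  by rewrite inE => /andP[].
rewrite -[s]card_ord; apply: (@leq_nu _ _ _ a) => // i.
by have := aG i; rewrite inE => /andP[].
Qed.

(** A kernel lies in the graph of a residual member, hence contains no dense pair. So u+1 disjoint
    kernels together with the dense pairs would be s disjoint kernels, giving s disjoint members of
    [F]. *)
Lemma residual_kernels_matching_free n s l (F : {set {perm 'I_n}}) u :
  0 < s -> 10 <= l -> n < 2 ^ l -> 2 ^ 16 * (s * l) <= n -> nu F < s ->
  u.+1 + #|dense_pairs F| = s ->
  matching_free u.+1 (spread_kernels (residual F) (2 ^ 9 * (s * l)) l).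
Proof.
move=> s0 l10 nl sn nuF us f fK.
have [nbig n0 Rn _ _] := size_bounds s0 l10 sn.
have [/existsP[i /existsP[j /andP[ij d]]]|dis] :=
  boolP [exists i, exists j, (i != j) && ~~ [disjoint f i & f j]]; first by exists i, j.
have {}dis i j : i != j -> [disjoint f i & f j].
  move=> ij; apply: contraNT dis => d; apply/existsP; exists i; apply/existsP; exists j.
  by rewrite ij d.
have /fin_all_exists[G GP] i : exists G : {set {perm 'I_n}},
    [&& G != set0, G \subset star (residual F) (f i) &
      [forall Z : {set 'I_n * 'I_n}, [disjoint Z & f i] ==>
        (#|star G Z| * (2 ^ 9 * (s * l)) ^ #|Z| <= #|G|)]].
  by have := fK i; rewrite inE => /andP[_ /existsP].
have fl i : #|f i| <= l by have := fK i; rewrite inE => /andP[].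
have G0 i : G i != set0 by case/and3P: (GP i).
have GF i s1 : s1 \in G i -> [/\ s1 \in F, [disjoint dense_pairs F & gr s1] & f i \subset gr s1].
  case/and3P: (GP i) => _ /subsetP h _ /h; rewrite inE => /andP[]; rewrite inE => /andP[-> ->] ->.
  by [].
have fE i e : e \in dense_pairs F -> e \notin f i.
  move=> eE; have /set0Pn[s1 /GF[_ d fg]] := G0 i; apply/negP => /(subsetP fg) eg.
  by move: d; rewrite disjoint_subset => /subsetP/(_ e eE); rewrite inE eg.
pose J := ('I_u.+1 + {e | e \in dense_pairs F})%type.
pose S (j : J) := match j with inl i => f i | inr e => [set val e] end.
pose H (j : J) := match j with inl i => G i | inr e => star F [set val e] end.
have JE : #|{: J}| = s by rewrite card_sum card_ord card_sig.
exfalso; move: nuF; apply/negP; rewrite -leqNgt -JE.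
have [||j|i j|j|j a|j Z Z0 dZ|a [aG da]] := @disjoint_system n s l J S H s0 _ nl sn.
- exact: leq_trans l10.
- by rewrite JE.
- by case: j => [i|e] /=; rewrite ?fl ?cards1 //; apply: leq_trans l10.
- case: i j => [i|[e eE]] [j|[e' eE']] /= ij.
  + by apply: dis; apply: contraNneq ij => ->.
  + by rewrite disjoint_sym disjoints1 fE.
  + by rewrite disjoints1 fE.
  + rewrite disjoints1 inE; apply: contraNneq ij => e1; apply/eqP; congr inr.
    exact: val_inj.
- case: j => [i|[e eE]] /=; first exact: G0.
  by have := leq_trans (fact_gt0 n.-1) (card_star_dense nbig eE); rewrite muln_gt0 card_gt0.
- by case: j => [i /GF[]|e] //=; rewrite inE => /andP[].
- case: j dZ => [i|[e eE]] /= dZ.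
    by case/and3P: (GP i) => _ _ /forallP/(_ Z)/implyP; apply.
  apply: (dense_star_spread Rn (card_star_dense nbig eE)) Z0 dZ => t.
  by rewrite inE => /andP[].
apply: (@leq_nu _ _ _ a) => // -[i|e]; first by have /GF[] := aG (inl i).
by have := aG (inr e); rewrite inE => /andP[].
Qed.

Lemma card_residual_lt n s l (F : {set {perm 'I_n}}) u :
  0 < s -> 10 <= l -> n < 2 ^ l -> 2 ^ 16 * (s * l) <= n -> nu F < s ->
  u.+1 + #|dense_pairs F| = s -> 0 < u ->
  #|residual F| < u * d_n1 n.
Proof.
move=> s0 l10 nl sn nuF us u0.
have [nbig n0 Rn ln Rl] := size_bounds s0 l10 sn.
have mf := residual_kernels_matching_free s0 l10 nl sn nuF us.
set R := 2 ^ 9 * (s * l) in mf Rn Rl.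
set K := spread_kernels _ _ _ in mf.
(* A dense pair lies in no residual member, so a single pair always costs at most 63/64 of
   [d_n1 n]. *)
pose c j := if j == 1 then (63 * d_n1 n) %/ 64 else (n - j)`!.
have cF (S : {set 'I_n * 'I_n}) : #|[set a in residual F | S \subset gr a]| <= c #|S|.
  rewrite /c; case: eqP => [/eqP/cards1P[e ->]|_]; last exact: card_star.
  have [eE|eE] := boolP (e \in dense_pairs F).
    rewrite (_ : [set _ in _ | _] = set0) ?cards0 //; apply/setP => a; rewrite !inE.
    apply/negP => /andP[/andP[_]]; rewrite disjoint_subset => /subsetP/(_ e eE).
    by rewrite !inE sub1set inE => /negbTE ->.
  rewrite leq_divRL // mulnC; apply: leq_trans (_ : 64 * #|star F [set e]| <= _).
    rewrite leq_mul2l; apply/subset_leq_card/subsetP => a.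
    by rewrite !inE => /andP[/andP[-> _] ->].
  by move: eE; rewrite inE -ltnNge => /ltnW.
have l0 : 0 < l by apply: leq_trans l10.
have Kl S : S \in K -> #|S| <= l.-1.+1 by rewrite prednK // inE => /andP[].
have := card_covered_le cF Kl mf; rewrite prednK //.
have -> : \sum_(2 <= j < l.+1) (u * j) ^ j * c j = \sum_(2 <= j < l.+1) (u * j) ^ j * (n - j)`!.
  by apply: eq_big_nat => j /andP[j2 _]; rewrite /c gtn_eqF.
set X := \sum_(_ <= _ < _) _.
have uX : 2 ^ 11 * X <= u * n.-1`!.
  apply: kernel_tail_le => //; apply: leq_trans sn; rewrite leq_mul2l leq_mul2r.
  by apply/orP; right; apply/orP; right; lia.
have c1 : 64 * c 1 <= 63 * d_n1 n by rewrite /c /= mulnC leq_divM.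
have unc := @card_uncovered n (residual F) R l ln.
have rest := @kernel_rest_le n l R.
(* Since l >= 10, 8^l is at least 2^12. *)
have {}unc : 2 ^ 12 * #|residual F :\: covered (residual F) (@gr n) K| <= n.-1`!.
  have h : 8 ^ l * (R ^ l * (n - l)`!) <= n.-1`!.
    by apply: rest => //; apply: leq_trans Rl (leq_subr _ _).
  apply: leq_trans h; apply: leq_mul; last by apply: unc; apply: leq_trans Rl; lia.
  by rewrite -[8]/(2 ^ 3) -expnM leq_exp2l //; lia.
have covF : covered (residual F) (@gr n) K \subset residual F.
  by apply/subsetP => a; rewrite inE => /andP[].
have := cardsD (residual F) (covered (residual F) (@gr n) K).
rewrite (setIidPr covF); have := subset_leq_card covF.
have N16 := fact_le_d_n1 nbig; have d0 := d_n1_gt0 nbig.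
move: unc uX; rewrite (_ : 2 ^ 12 = 4096) // (_ : 2 ^ 11 = 2048) //.
set N := n.-1`! in N16 *; set d := d_n1 n in N16 d0 c1 *.
set v := #|_ :\: _|; set w := #|covered _ _ _|; set z := #|residual F| => unc uX wz vE wle.
have uN : u * N <= u * (16 * d) by rewrite leq_mul2l N16 orbT.
have uc : u * (64 * c 1) <= u * (63 * d) by rewrite leq_mul2l c1 orbT.
have ud : d <= u * d by rewrite leq_pmull.
have : 0 < u * d by rewrite muln_gt0 u0 d0.
(* As (n-1)! <= 16d, the total is at most (63/64 + 16/2048 + 16/4096) ud, that is 255/256 of ud. *)
by lia.
Qed.

Lemma residual_eq0 n s l (F : {set {perm 'I_n}}) :
  0 < s -> 10 <= l -> n < 2 ^ l -> 2 ^ 16 * (s * l) <= n -> F \subset Dn n -> nu F < s ->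
  #|dense_pairs F|.+1 = s -> residual F = set0.
Proof.
move=> s0 l10 nl sn FD nuF us.
have [nbig n0 Rn ln Rl] := size_bounds s0 l10 sn.
apply/eqP; apply: contraTT nuF => /set0Pn[t]; rewrite inE => /andP[tF tE].
rewrite -leqNgt -us.
pose G e := [set a in star F [set e] | [disjoint gr a & gr t]].
(* At least (n-1)!/16 derangements through [e] avoid [t], and at most (n-1)!/64 of them are missing
   from [F]; the difference 3/64 exceeds 1/24. *)
have Gbig e : e \in dense_pairs F -> n.-1`! <= 24 * #|G e|.
  case: e => x y eE; have xy := dense_pair_offdiag nbig FD eE.
  have txy : t x != y.
    move: tE; rewrite disjoint_subset => /subsetP/(_ _ eE); by rewrite !inE.
  have av := card_Dpair_avoid nbig xy txy.
  have sub := star_sub_Dpair x y FD.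
  have := cardsD (Dpair x y) (star F [set (x, y)]).
  rewrite (setIidPr sub) (card_Dpair xy) => eD.
  have : #|[set s in Dpair x y | [disjoint gr s & gr t]]| <=
         #|G (x, y)| + #|Dpair x y :\: star F [set (x, y)]|.
    apply: leq_trans (leq_card_setU _ _); apply/subset_leq_card/subsetP => a.
    rewrite inE => /andP[aD dt]; rewrite in_setU in_setD aD andbT [a \in G _]inE dt andbT.
    exact: orbN.
  have : d_n1 n <= n.-1`!.
    by rewrite -(card_Dpair xy) Dpair_star -subn1 -(cards1 (x, y)) card_star.
  have := card_star_le_d nbig FD eE.
  move: eE av; rewrite inE eD.
  set c1 := #|star _ _|; set c2 := #|[set _ in Dpair _ _ | _]|; set c3 := #|G _|.
  lia.
have Gt e a : a \in G e -> [/\ a \in F, [set e] \subset gr a & [disjoint gr a & gr t]].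
  by rewrite inE => /andP[]; rewrite inE => /andP[].
pose J := {e | e \in dense_pairs F}.
have [|||i j ij|j|j a /Gt[] //|j Z Z0 dZ|a [aG da]] := @disjoint_system n s l J
   (fun e => [set val e]) (fun e => G (val e)) s0 _ nl sn.
- exact: leq_trans l10.
- by rewrite card_sig -us leqnSn.
- by move=> e; rewrite cards1; apply: leq_trans l10.
- by rewrite disjoints1 inE; apply: contraNneq ij => /val_inj ->.
- by have := leq_trans (fact_gt0 n.-1) (Gbig _ (valP j)); rewrite muln_gt0 card_gt0.
- by apply: (dense_star_spread Rn (Gbig _ (valP j))) Z0 dZ => b /Gt[].
(* The extra element [None] stands for [t] itself, disjoint from all chosen members. *)
have -> : #|dense_pairs F|.+1 = #|{: option J}| by rewrite card_option card_sig.
apply: (@leq_nu _ _ _ (fun o => if o is Some j then a j else t)) => //.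
  by case=> [j|] //; have /Gt[] := aG j.
case=> [i|] [j|] // ij.
- by apply: da; apply: contraNneq ij => ->.
- by have /Gt[] := aG i.
- by rewrite disjoint_sym; have /Gt[] := aG j.
Qed.

(** * From the real logarithm to an integer bound *)

Lemma INR_exp2 k : INR (2 ^ k) = (2 ^ k)%R.
Proof. by elim: k => [|k IH] //; rewrite expnS mult_INR IH. Qed.

(** From e <= 3 and 3^12 < 2^20 it follows that 12 < 20 ln 2. *)
Lemma ln2_gt : (6 / 10 < ln 2)%R.
Proof.
have e12 : (exp 12 < 2 ^ 20)%R.
  have -> : exp 12 = (exp 1 ^ 12)%R.
    by rewrite -[12%R]Rmult_1_r -[X in exp (X * _)](INR_IZR_INZ 12) Rmult_comm -Rpower_pow ?/Rpower ?ln_exp //;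
       [congr exp; ring | apply: exp_pos].
  apply: (Rle_lt_trans _ (3 ^ 12)); last by lra.
  apply: pow_incr; split; [exact/Rlt_le/exp_pos | exact: exp_le_3].
have := ln_increasing _ _ (exp_pos 12) e12.
rewrite ln_exp ln_pow; last by lra.
rewrite INR_IZR_INZ /=; lra.
Qed.

Lemma log_bound n s :
  (INR s <= INR n / (2 ^ 17 * ln (INR n)))%R -> 0 < s ->
  [/\ 10 <= (trunc_log 2 n).+1, n < 2 ^ (trunc_log 2 n).+1
    & 2 ^ 16 * (s * (trunc_log 2 n).+1) <= n].
Proof.
move=> hs s0.
have s1 : (1 <= INR s)%R by apply: (le_INR 1); apply/leP.
case: n hs => [|[|n]] hs.
- by move: hs; rewrite /Rdiv /= Rmult_0_l; lra.
(* Here ln 1 = 0 and division by zero yields 0, so the hypothesis contradicts s >= 1. *)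
- by move: hs; rewrite /= ln_1 Rmult_0_r /Rdiv Rinv_0; lra.
move: hs; set m := n.+2 => hs.
set k := trunc_log 2 m.
have k0 : 0 < k by rewrite trunc_log_gt0.
have km : 2 ^ k <= m by apply: trunc_logP.
have lnm : (INR k * ln 2 <= ln (INR m))%R.
  rewrite -ln_pow; last by lra.
  have p2 : (0 < 2 ^ k)%R by apply: pow_lt; lra.
  have : (2 ^ k <= INR m)%R by rewrite -INR_exp2; apply/le_INR/leP.
  by case=> [lt|<-]; [left; apply: ln_increasing | right].
have l2 := ln2_gt.
have k1 : (1 <= INR k)%R by apply: (le_INR 1); apply/leP.
have lk : (6 / 10 * INR k <= ln (INR m))%R.
  by apply: Rle_trans lnm; rewrite Rmult_comm; apply: Rmult_le_compat_l; lra.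
have hm : (INR s * (2 ^ 17 * ln (INR m)) <= INR m)%R.
  have p : (0 < 2 ^ 17 * ln (INR m))%R by apply: Rmult_lt_0_compat; lra.
  have := Rmult_le_compat_r _ _ _ (Rlt_le _ _ p) hs.
  by rewrite /Rdiv Rmult_assoc Rinv_l ?Rmult_1_r //; lra.
have hk : (INR s * (2 ^ 17 * (6 / 10 * INR k)) <= INR m)%R.
  apply: Rle_trans hm; apply: Rmult_le_compat_l; first by lra.
  by apply: Rmult_le_compat_l; lra.
(* Already s >= 1 and k >= 1 give n >= 0.6 * 2^17 > 2^16. Then 1.2 k >= k + 1 gives the last
   bound. *)
have k16 : 16 <= k.
  rewrite trunc_log_max //; apply/leP/INR_le; rewrite INR_exp2.
  by apply: Rle_trans hk; nra.
split; [exact: leq_trans (leqW k16) | exact: trunc_log_ltn |].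
apply/leP/INR_le; rewrite (mult_INR (2 ^ 16)) (mult_INR s) INR_exp2 S_INR.
have k16R : (16 <= INR k)%R by have := le_INR _ _ (leP k16); rewrite /=; lra.
by apply: Rle_trans hk; nra.
Qed.

(** * Collinearity and the equality case *)

Lemma collinear_pairs (A B : eqType) (E : {pred A * B}) e0 :
  e0 \in E -> (forall e e', e \in E -> e' \in E -> e.1 = e'.1 \/ e.2 = e'.2) ->
  (exists2 e1, e1 \in E & e1.1 != e0.1) -> forall e, e \in E -> e.2 = e0.2.
Proof.
(* If [e] left the column of [e0], it would share the row of [e0], while [e1] shares the column;
   then [e] and [e1] agree in neither coordinate. *)
move=> e0E col [e1 e1E ne] e eE; apply/eqP; apply: contraT => ne2.
have e10 : e1.2 = e0.2 by case: (col e1 e0 e1E e0E) => // h; rewrite h eqxx in ne.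
have ee0 : e.1 = e0.1 by case: (col e e0 eE e0E) => // h; rewrite h eqxx in ne2.
case: (col e e1 eE e1E) => h; first by rewrite -h ee0 eqxx in ne.
by rewrite h e10 eqxx in ne2.
Qed.

Lemma sum_pinned (I : finType) (A : {set I}) (f : I -> nat) d :
  (forall i, i \in A -> f i <= d) -> #|A| * d <= \sum_(i in A) f i ->
  forall i, i \in A -> f i = d.
Proof.
move=> fd le i iA; apply/eqP; rewrite eqn_leq fd //= leqNgt; apply/negP => lt.
move: le; rewrite leqNgt => /negP[]; rewrite -sum_nat_const (bigD1 i iA) [X in _ < X](bigD1 i iA) /=.
by rewrite -addSn leq_add // leq_sum // => j /andP[/fd].
Qed.

(** The integer [l] plays the part of the binary logarithm of n, which keeps real numbers out of the
    combinatorics. *)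
Theorem derangements_matching_bound (n s l : nat) (F : {set {perm 'I_n}}) :
  10 <= l -> n < 2 ^ l -> 2 ^ 16 * (s * l) <= n ->
  F \subset Dn n -> nu F < s ->
  #|F| <= (s - 1) * d_n1 n /\
  (#|F| = (s - 1) * d_n1 n ->
     (exists (x : 'I_n) (Y : {set 'I_n}),
         #|Y| = s - 1 /\ x \notin Y /\ F = \bigcup_(y in Y) Dpair x y)
     \/
     (exists (y : 'I_n) (X : {set 'I_n}),
         #|X| = s - 1 /\ y \notin X /\ F = \bigcup_(x in X) Dpair x y)).
Proof.
move=> l10 nl sn FD nuF.
have s0 : 0 < s by apply: leq_ltn_trans nuF.
have [nbig n0 _ _ _] := size_bounds s0 l10 sn.
have Es := leq_nu_dense s0 l10 nl sn nuF.
set E := dense_pairs F in Es.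
have d0 := d_n1_gt0 nbig.
have Fcov : F \subset residual F :|: \bigcup_(e in E) star F [set e].
  apply/subsetP => a aF; rewrite in_setU [a \in residual F]inE aF /=.
  have [//|] := boolP [disjoint _ & _]; rewrite -setI_eq0 => /set0Pn[e]; rewrite inE => /andP[eE ea].
  by apply/bigcupP; exists e => //; rewrite inE aF sub1set.
have starE e : e \in E -> #|star F [set e]| <= d_n1 n by apply: card_star_le_d.
(* With fewer than s-1 dense pairs the bound is strict, so equality can only occur in the other
   case. *)
have [u0|u0] := posnP (s.-1 - #|E|); last first.
  set u := s.-1 - #|E| in u0.
  have us : u.+1 + #|E| = s by rewrite /u; lia.
  have lt := card_residual_lt s0 l10 nl sn nuF us u0.
  have : #|F| < (s - 1) * d_n1 n.
    apply: leq_ltn_trans (subset_leq_card Fcov) _.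
    apply: leq_ltn_trans (leq_card_setU _ _) _.
    have -> : s - 1 = u + #|E| by lia.
    rewrite mulnDl -addSn leq_add //.
    apply: leq_trans (leq_card_bigcup _ _) _; rewrite -sum_nat_const; exact: leq_sum.
  by move=> h; split; [exact: ltnW | move=> e; rewrite e ltnn in h].
have sE : #|E|.+1 = s by lia.
have res0 := residual_eq0 s0 l10 nl sn FD nuF sE.
rewrite res0 set0U in Fcov.
have -> : s - 1 = #|E| by lia.
have sumE : \sum_(e in E) #|star F [set e]| <= #|E| * d_n1 n.
  by rewrite -sum_nat_const; apply: leq_sum.
have Fle := leq_trans (subset_leq_card Fcov) (leq_card_bigcup _ _).
split=> [|Feq]; first exact: leq_trans Fle sumE.
(* Equality in the union bound forces every dense star to have the maximal size. *)
have full : forall e, e \in E -> #|star F [set e]| = d_n1 n.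
  by apply: (sum_pinned starE); rewrite -Feq; exact: Fle.
have off x y : (x, y) \in E -> x != y by apply: dense_pair_offdiag.
have starD x y : (x, y) \in E -> star F [set (x, y)] = Dpair x y.
  move=> eE; apply/eqP; rewrite eqEcard star_sub_Dpair // full //.
  by rewrite (card_Dpair (off _ _ eE)) leqnn.
have FU : F = \bigcup_(e in E) Dpair e.1 e.2.
  apply/eqP; rewrite eqEsubset; apply/andP; split.
    apply: subset_trans Fcov _; apply/bigcupsP => -[x y] eE.
    by rewrite starD //; apply: (bigcup_max (x, y)).
  by apply/bigcupsP => -[x y] eE; rewrite -starD //; apply/subsetP => a; rewrite inE => /andP[].
have col e e' : e \in E -> e' \in E -> e.1 = e'.1 \/ e.2 = e'.2.
  case: e e' => [x y] [x' y'] eE eE' /=.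
  have [->|xx] := eqVneq x x'; first by left.
  have [->|yy] := eqVneq y y'; first by right.
  exfalso; have [a /andP[a1 a2]] := Dpair_meet nbig (off _ _ eE) (off _ _ eE') xx yy.
  (* Two pairs in general position share a derangement [a]. It may be dropped from one of the two
     stars, so the union has fewer than |E| d members. *)
  have : F \subset (Dpair x y :\ a) :|: \bigcup_(e in E :\ (x, y)) star F [set e].
    apply/subsetP => b bF; have := subsetP Fcov b bF => /bigcupP[[z w] zE bz].
    rewrite in_setU; have [e1|ne1] := eqVneq (z, w) (x, y); last first.
      by apply/orP; right; apply/bigcupP; exists (z, w); rewrite ?in_setD1 ?ne1.
    have [->|ba] := eqVneq b a.
      apply/orP; right; apply/bigcupP; exists (x', y'); last by rewrite starD.
      by rewrite in_setD1 eE' andbT; apply: contraNneq xx => -[->].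
    by apply/orP; left; rewrite in_setD1 ba -starD // -e1.
  move=> /subset_leq_card; apply/negP; rewrite -ltnNge Feq.
  apply: leq_ltn_trans (leq_card_setU _ _) _.
  apply: leq_ltn_trans (leq_add (leqnn _) (leq_card_bigcup _ _)) _.
  have := cardsD1 a (Dpair x y); rewrite a1 (card_Dpair (off _ _ eE)) => dE.
  have := cardsD1 (x, y) E; rewrite eE => ->.
  rewrite mulnDl mul1n -addSn leq_add //; first by rewrite dE.
  by rewrite -sum_nat_const leq_sum // => e; rewrite inE => /andP[_ /starE].
(* When there are no dense pairs, [F] is an empty union and any [x] serves. *)
have [E0|/set0Pn[[x0 y0] e0E]] := eqVneq E set0.
  left; exists (Ordinal n0), set0; rewrite E0 !cards0 inE; do 2?split=> //.
  by rewrite FU E0 !big_set0.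
have [/existsP[e1 /andP[e1E ne]]|] := boolP [exists e, (e \in E) && (e.1 != x0)].
  right; have col2 : forall e, e \in E -> e.2 = y0.
    by apply: (@collinear_pairs _ _ (mem E) (x0, y0)) => //; exists e1.
  exists y0, [set x | (x, y0) \in E]; split; last split.
  - rewrite -(@card_in_imset _ _ fst E).
      apply: eq_card => x; rewrite inE; apply/idP/imsetP => [h|[[x' y] eE ->]].
        by exists (x, y0).
      by have := col2 _ eE => /= <-.
    by move=> [x y] [x' y'] /col2/= -> /col2/= -> /= ->.
  - by rewrite inE; apply/negP => /off; rewrite eqxx.
  - rewrite {1}FU; apply/setP => a; apply/bigcupP/bigcupP => [[[x y] eE aD]|[x]].
      by have /= yE := col2 _ eE; exists x; [rewrite inE -yE | rewrite -yE].
    by rewrite inE => xE aD; exists (x, y0).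
rewrite negb_exists => /forallP row; left.
have row2 e : e \in E -> e.1 = x0.
  by move=> eE; have := row e; rewrite eE negbK => /eqP.
exists x0, [set y | (x0, y) \in E]; split; last split.
- rewrite -(@card_in_imset _ _ snd E).
    apply: eq_card => y; rewrite inE; apply/idP/imsetP => [h|[[x y'] eE ->]].
      by exists (x0, y).
    by have := row2 _ eE => /= <-.
  by move=> [x y] [x' y'] /row2/= -> /row2/= -> /= ->.
- by rewrite inE; apply/negP => /off; rewrite eqxx.
- rewrite {1}FU; apply/setP => a; apply/bigcupP/bigcupP => [[[x y] eE aD]|[y]].
    by have /= xE := row2 _ eE; exists y; [rewrite inE -xE | rewrite -xE].
  by rewrite inE => yE aD; exists (x0, y).
Qed.

Theorem theorem5 (n s : nat) (F : {set {perm 'I_n}}) :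
  (INR s <= INR n / (2 ^ 17 * ln (INR n)))%R ->
  F \subset Dn n ->
  nu F < s ->
  #|F| <= (s - 1) * d_n1 n /\
  (#|F| = (s - 1) * d_n1 n ->
     (exists (x : 'I_n) (Y : {set 'I_n}),
         #|Y| = s - 1 /\ x \notin Y /\ F = \bigcup_(y in Y) Dpair x y)
     \/
     (exists (y : 'I_n) (X : {set 'I_n}),
         #|X| = s - 1 /\ y \notin X /\ F = \bigcup_(x in X) Dpair x y)).
Proof.
move=> hs FD nuF.
have [l10 nl sn] := log_bound hs (leq_ltn_trans (leq0n _) nuF).
exact: derangements_matching_bound l10 nl sn FD nuF.
Qed.
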